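(* Let $K$ be a closed subset of $\mathbb{H}$. Suppose that $E$ is a two-sided $*$-invariant $\mathbb{H}$-linear subspace of $C(K;\mathbb{H})$ such that $E_{\mathrm{her}}$ is an adapted subspace of $C(K;\mathbb{R})$. Let $L:E\to\mathbb{H}$ be an $\mathbb{H}$-linear functional on $E$. Then the following are equivalent: (i) The functional $L$ is $E_+$-positive, that is, $L(f)\geq 0$ for all $f\in E_+$. (ii) For each $f\in E_+$ there exists an $h\in E_+$ such that $L(f+\varepsilon h)\geq 0$ for all $\varepsilon>0$. (iii) $L$ is a $K$-moment functional on $E$, that is, there exists a positive Radon measure $\mu$ on $K$ such that $L(f)=\int_K f(x)\,d\mu(x)$ for all $f\in E$.
   Context: $\mathbb{H}$ is the algebra of quaternions $q=x_0+x_1\mathrm{i}+x_2\mathrm{j}+x_3\mathrm{k}$, identified as a topological space with $\mathbb{R}^4$, with conjugation $q^*=x_0-x_1\mathrm{i}-x_2\mathrm{j}-x_3\mathrm{k}$. $C(K;\mathbb{H})$ (resp. $C(K;\mathbb{R})$) denotes the continuous $\mathbb{H}$-valued (resp. real-valued) functions on the locally compact space $K$, with pointwise operations; for $f\in C(K;\mathbb{H})$ put $f^*(x):=f(x)^*$. A subspace $E$ is two-sided $\mathbb{H}$-linear if $afb+cgd\in E$ for all $f,g\in E$, $a,b,c,d\in\mathbb{H}$; it is $*$-invariant if $f\in E$ implies $f^*\in E$. $E_{\mathrm{her}}:=\{f\in E: f=f^*\}$ is the set of real-valued functions in $E$, and $E_+:=\{f\in E_{\mathrm{her}}: f(x)\ge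 0 \text{ for all } x\in K\}$. An $\mathbb{H}$-linear functional on $E$ is a map $L:E\to\mathbb{H}$ with $L(afb+cgd)=aL(f)b+cL(g)d$ for all $f,g\in E$, $a,b,c,d\in\mathbb{H}$. For a quaternion $p$, ''$p\ge 0$'' means that $p$ is real and nonnegative. The integral of an $\mathbb{H}$-valued function is taken componentwise, and the integral formula includes integrability of all $f\in E$. Adapted space: for a locally compact Hausdorff space $X$, a real linear subspace $E_{\mathbb{R}}$ of $C(X;\mathbb{R})$, with $E_+:=\{f\in E_{\mathbb{R}}: f\ge 0 \text{ on } X\}$, is called adapted if (1) $E_{\mathbb{R}}=E_+-E_+$; (2) for each $x\in X$ there is $f\in E_+$ with $f(x)>0$; (3) for each $f\in E_+$ there is $g\in E_+$ such that for every $\varepsilon>0$ there is a compact $K_\varepsilon\subseteq X$ with $f(x)\le\varepsilon g(x)$ for all $x\in X\setminus K_\varepsilon$. *)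

(* Defs.v *)
From HB Require Import structures.
From mathcomp Require Import all_boot all_order all_algebra.
From mathcomp Require Import all_classical all_reals all_analysis.
From mathcomp Require Import ring.

Set Implicit Arguments.
Unset Strict Implicit.
Unset Printing Implicit Defensive.

Import Order.TTheory GRing.Theory Num.Theory.
Import numFieldNormedType.Exports.

Local Open Scope classical_set_scope.
Local Open Scope ring_scope.

(* The row (x0, x1, x2, x3) stands for x0 + x1 i + x2 j + x3 k. Only the real
   vector space structure and the topology of 'rV[R]_4 are inherited: its
   sup norm is not the quaternion norm. *)
Definition quat (R : realType) : Type := 'rV[R]_4.

HB.instance Definition _ (R : realType) := GRing.Lmodule.copy (quat R) 'rV[R]_4.
HB.instance Definition _ (R : realType) :=
  PointedTopological.copy (quat R) 'rV[R]_4.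

Section quaternion_algebra.
Context {R : realType}.
Implicit Types (p q r : quat R) (a : R).

Definition mkquat (x0 x1 x2 x3 : R) : quat R :=
  \row_(l < 4) [:: x0; x1; x2; x3]`_l.

Definition quat_coord q (l : 'I_4) : R := (q : 'rV[R]_4) 0 l.

Definition qre q : R := quat_coord q (inord 0).
Definition qi q : R := quat_coord q (inord 1).
Definition qj q : R := quat_coord q (inord 2).
Definition qk q : R := quat_coord q (inord 3).

Lemma mkquatE x0 x1 x2 x3 (q := mkquat x0 x1 x2 x3) :
  (qre q = x0) * (qi q = x1) * (qj q = x2) * (qk q = x3).
Proof.
by rewrite /q /qre /qi /qj /qk /quat_coord /mkquat !mxE !inordK.
Qed.

Lemma quatP p q :
  qre p = qre q -> qi p = qi q -> qj p = qj q -> qk p = qk q -> p = q.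
Proof.
move=> h0 h1 h2 h3; apply/rowP => l.
rewrite -[l]inord_val; case: l => -[|[|[|[|//]]]] /= _.
- exact: h0.
- exact: h1.
- exact: h2.
- exact: h3.
Qed.

Lemma quatDE p q : (qre (p + q) = qre p + qre q) * (qi (p + q) = qi p + qi q) *
  (qj (p + q) = qj p + qj q) * (qk (p + q) = qk p + qk q).
Proof. by rewrite /qre /qi /qj /qk /quat_coord !mxE. Qed.

Lemma quatZE a q : (qre (a *: q) = a * qre q) * (qi (a *: q) = a * qi q) *
  (qj (a *: q) = a * qj q) * (qk (a *: q) = a * qk q).
Proof. by rewrite /qre /qi /qj /qk /quat_coord !mxE. Qed.

Lemma quat0E : (qre (0 : quat R) = 0) * (qi (0 : quat R) = 0) *
  (qj (0 : quat R) = 0) * (qk (0 : quat R) = 0).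
Proof. by rewrite /qre /qi /qj /qk /quat_coord !mxE. Qed.

Definition quat1 : quat R := mkquat 1 0 0 0.

Definition mulq p q : quat R := mkquat
  (qre p * qre q - qi p * qi q - qj p * qj q - qk p * qk q)
  (qre p * qi q + qi p * qre q + qj p * qk q - qk p * qj q)
  (qre p * qj q - qi p * qk q + qj p * qre q + qk p * qi q)
  (qre p * qk q + qi p * qj q - qj p * qi q + qk p * qre q).

Definition conjq q : quat R := mkquat (qre q) (- qi q) (- qj q) (- qk q).

Local Ltac quat_ring :=
  apply: quatP; rewrite /mulq /quat1 !(mkquatE, quatDE, quatZE); ring.

Lemma mulqA : associative mulq. Proof. by move=> p q r; quat_ring. Qed.
Lemma mul1q : left_id quat1 mulq. Proof. by move=> p; quat_ring. Qed.
Lemma mulq1 : right_id quat1 mulq. Proof. by move=> p; quat_ring. Qed.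
Lemma mulqDl : left_distributive mulq +%R.
Proof. by move=> p q r; quat_ring. Qed.
Lemma mulqDr : right_distributive mulq +%R.
Proof. by move=> p q r; quat_ring. Qed.
Lemma quat1_neq0 : quat1 != 0.
Proof.
apply/eqP => /(congr1 qre); rewrite mkquatE quat0E => /eqP.
by rewrite oner_eq0.
Qed.

HB.instance Definition _ := GRing.Zmodule_isNzRing.Build (quat R)
  mulqA mul1q mulq1 mulqDl mulqDr quat1_neq0.

Lemma quat_scaleAl a p q : a *: (p * q) = a *: p * q.
Proof. by rewrite /GRing.mul /=; quat_ring. Qed.
HB.instance Definition _ :=
  GRing.Lmodule_isLalgebra.Build R (quat R) quat_scaleAl.

Lemma quat_scaleAr a p q : a *: (p * q) = p * (a *: q).
Proof. by rewrite /GRing.mul /=; quat_ring. Qed.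
HB.instance Definition _ :=
  GRing.Lalgebra_isAlgebra.Build R (quat R) quat_scaleAr.

(* p >= 0: p is real and nonnegative. *)
Definition quat_ge0 p : Prop := exists2 a : R, 0 <= a & p = a%:A.

End quaternion_algebra.

HB.instance Definition _ (R : realType) :=
  Measurable.copy (quat R) (g_sigma_algebraType (@open (quat R))).

Section adapted_spaces.
Context {R : realType} {X : topologicalType}.
Implicit Types E : set (X -> R).

Definition real_subspace E : Prop :=
  E (fun=> 0) /\
  forall (a b : R) f g, E f -> E g -> E (fun x => a * f x + b * g x).

Definition nneg_part E : set (X -> R) := [set f | E f /\ forall x, 0 <= f x].

Definition adapted E : Prop :=
  [/\ real_subspace E /\ (forall f, E f -> continuous f),
      E = [set (fun x => f x - g x) | f in nneg_part E & g in nneg_part E],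
      forall x, exists2 f, nneg_part E f & 0 < f x
    & forall f, nneg_part E f -> exists2 g, nneg_part E g &
        forall eps : R, 0 < eps -> exists2 C : set X, compact C &
          forall x, ~ C x -> f x <= eps * g x].

End adapted_spaces.

Section quaternionic_moments.
Context {R : realType} {K : set (quat R)}.
Implicit Types (E : set (K -> quat R)) (L : (K -> quat R) -> quat R).

(* In this section K also denotes the subtype of its points, with the topology
   induced by that of the quaternions. *)

Definition two_sided_subspace E : Prop :=
  E (fun=> 0) /\
  forall (a b c d : quat R) f g, E f -> E g ->
    E (fun x => a * f x * b + c * g x * d).

Definition conj_invariant E : Prop := forall f, E f -> E (conjq \o f).

Definition her E : set (K -> quat R) := [set f | E f /\ f = conjq \o f].

Definition her_real E : set (K -> R) := [set g | her E (fun x => (g x)%:A)].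

Definition her_nneg E : set (K -> quat R) :=
  [set f | her E f /\ forall x, quat_ge0 (f x)].

(* A functional on E is a total function whose values outside E are junk. *)
Definition quat_linear_on E L : Prop :=
  forall (a b c d : quat R) f g, E f -> E g ->
    L (fun x => a * f x * b + c * g x * d) = a * L f * b + c * L g * d.

Definition positive_functional E L : Prop :=
  forall f, her_nneg E f -> quat_ge0 (L f).

(* A measure on the Borel sets of the closed set K is represented by its
   extension by zero to the Borel sets of the quaternions: the measurable
   structures of the library need a point, and K may be empty. *)
Definition radon_measure_on (mu : {measure set (quat R) -> \bar R}) : Prop :=
  [/\ mu (~` K) = 0%E,
      forall C : set (quat R), compact C -> C `<=` K -> (mu C < +oo)%E
    & forall B : set (quat R), measurable B -> B `<=` K ->
        mu B = ereal_sup [set mu C | C in [set C | compact C /\ C `<=` B]]].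

(* [valL_ 0 f] extends f by 0 outside K, where the integrals do not look. *)
Definition coord_on (f : K -> quat R) (l : 'I_4) (x : quat R) : R :=
  quat_coord (valL_ 0 f x) l.

Definition quat_integrable (mu : {measure set (quat R) -> \bar R})
    (f : K -> quat R) : Prop :=
  forall l, mu.-integrable K (EFin \o coord_on f l).

Definition quat_integral (mu : {measure set (quat R) -> \bar R})
    (f : K -> quat R) : quat R :=
  \row_l (\int[mu]_(x in K) coord_on f l x)%R.

Definition moment_functional E L : Prop :=
  exists mu : {measure set (quat R) -> \bar R}, radon_measure_on mu /\
    forall f, E f -> quat_integrable mu f /\ L f = quat_integral mu f.

End quaternionic_moments.

Arguments radon_measure_on {R} K mu.

(* Main.v *)
Require Import Defs.
From HB Require Import structures.
From mathcomp Require Import all_boot all_order all_algebra.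
From mathcomp Require Import all_classical all_reals all_analysis.
From mathcomp Require Import measurable_realfun ring lra.

Set Implicit Arguments.
Unset Strict Implicit.
Unset Printing Implicit Defensive.

Import Order.TTheory GRing.Theory Num.Theory.
Import numFieldNormedType.Exports.

Local Open Scope classical_set_scope.
Local Open Scope ring_scope.

(* The only substantial implication is that positivity yields a measure. A
   positive functional on [E_her] extends, by M. Riesz's extension theorem, to
   a positive functional on the continuous functions dominated by [E_+]; since
   the space is adapted, Dini's theorem makes this extension continuous along
   sequences decreasing to 0, so that it is a Daniell integral. Its outer
   measure restricts to a Borel measure, and cutting a nonnegative function
   into layers of height [d] shows that it is represented by that measure. The
   values of [L] follow from those on [E_her] by decomposing [f] into its four
   real coordinates, which lie in [E_her]. *)

(** [E_her] need not be closed under minima or under multiplication by bounded continuous functions,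
    yet cutting into layers needs the former and the Carathéodory condition the latter. The larger
    space contains every continuous function dominated by one of its members, hence allows both. The
    extension comes from a choice, so that nothing but linearity and positivity is known of it, and
    its continuity has to be drawn from adaptedness: condition (3) controls a decreasing sequence
    outside a compact set, and condition (2) yields a function of [E_+] that is at least 1 on this
    compact set, where the convergence is uniform. The same function bounds the measure of compact
    sets. Condition (1) reduces everything to nonnegative functions.

    The functional and the integral of a layer are only trapped between multiples of the measures of
    two consecutive level sets. The comparison is thus off by one layer, which is why the bottom
    layer is removed before [d] tends to 0. *)

(** * Positive extension of linear functionals *)

Section riesz_extension.
Context {R : realType} {V : lmodType R}.
Variables (C E : set V) (L : V -> R).
Hypothesis coneC : forall (a b : R) v w, 0 <= a -> 0 <= b -> C v -> C w ->
  C (a *: v + b *: w).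
Hypothesis subE : forall (a b : R) v w, E v -> E w -> E (a *: v + b *: w).
Hypothesis linL : forall (a b : R) v w, E v -> E w ->
  L (a *: v + b *: w) = a * L v + b * L w.
Hypothesis posL : forall v, E v -> C v -> 0 <= L v.
Hypothesis E0 : E 0.
Hypothesis C0 : C 0.

Let dominated (v : V) := exists2 e, E e & C (e - v) /\ C (e + v).

(* Partial extensions of [L] are represented by their graphs. *)
Let positive_graph (G : set (V * R)) :=
  [/\ forall v, E v -> G (v, L v),
      forall (a b : R) v w r s, G (v, r) -> G (w, s) ->
        G (a *: v + b *: w, a * r + b * s)
    & forall v r, G (v, r) -> C v -> 0 <= r].

(** The pair [(0, r - s)] lies in the graph and 0 in the cone, so positivity alone forces a graph to
    be single-valued. *)
Let graph_unique G v r s : positive_graph G -> G (v, r) -> G (v, s) -> r = s.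
Proof.
move=> [_ linG posG] Gr Gs.
have H x y : G (v, x) -> G (v, y) -> 0 <= x - y.
  move=> Gx Gy; apply: (posG 0) => //.
  have := linG 1 (-1) _ _ _ _ Gx Gy.
  by rewrite scale1r scaleN1r subrr mul1r mulN1r.
by apply/eqP; rewrite eq_le -subr_ge0 H // -subr_ge0 H.
Qed.

(* The admissible values at [v0] are those between [- r] for [(e, r)] in the
   graph with [e + v0] in the cone, and [r] for [(e, r)] in the graph with
   [e - v0] in the cone. *)
Let graph_step G v0 : positive_graph G -> dominated v0 ->
  exists2 G', positive_graph G' & G `<=` G' /\ exists r, G' (v0, r).
Proof.
move=> [LG linG posG] [e Ee [Cem Cep]].
pose S := [set - x.2 | x in [set x | G x /\ C (x.1 + v0)]].
have Sub e' r' : G (e', r') -> C (e' - v0) -> ubound S r'.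
  move=> Ge' Ce' _ [[f s] /= [Gf Cf] <-].
  have Gef := linG 1 1 _ _ _ _ Ge' Gf.
  rewrite -subr_ge0 opprK; rewrite !mul1r in Gef.
  apply: (posG _ _ Gef).
  have := coneC ler01 ler01 Ce' Cf.
  by rewrite !scale1r addrACA addNr addr0.
have hS : has_sup S.
  split; first by exists (- L e), (e, L e) => //; split=> //; exact: LG.
  by exists (L e); apply: (Sub e) => //; exact: LG.
pose c := sup S.
have c_ge f s : G (f, s) -> C (f + v0) -> - s <= c.
  by move=> Gf Cf; apply: ub_le_sup; [case: hS|exists (f, s)].
have c_le f s : G (f, s) -> C (f - v0) -> c <= s.
  by move=> Gf Cf; apply: ge_sup; [case: hS|exact: Sub Gf Cf].
pose G' : set (V * R) :=
  [set y | exists x t, G x /\ y = (x.1 + t *: v0, x.2 + t * c)].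
exists G'; last first.
  split.
    move=> [v r] Gv; exists (v, r), 0; split => //=.
    by rewrite scale0r mul0r !addr0.
  exists c, (0, 0), 1; split; last by rewrite /= scale1r mul1r !add0r.
  have := linG 0 0 _ _ _ _ (LG _ E0) (LG _ E0).
  by rewrite !scale0r !mul0r !addr0.
split.
- move=> v Ev; exists (v, L v), 0; split=> /=; first exact: LG.
  by rewrite scale0r mul0r !addr0.
- move=> a b v w r s [[v1 r1] [t1 [/= G1 [-> ->]]]] [[v2 r2] [t2 [/= G2 [-> ->]]]].
  exists (a *: v1 + b *: v2, a * r1 + b * r2), (a * t1 + b * t2) => /=.
  split; first exact: linG.
  congr (_, _); last by ring.
  by rewrite !scalerDr !scalerDl !scalerA addrACA.
- move=> v r [[f s] [t [/= Gf [-> ->]]]] Cv.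
  have CZ a : 0 <= a -> C (a *: (f + t *: v0)).
    by move=> a0; have := coneC a0 (lexx 0) Cv C0; rewrite scale0r addr0.
  have GZ a : G (a *: f, a * s).
    have := linG a 0 _ _ _ _ Gf Gf.
    by rewrite scale0r mul0r !addr0.
  (* Dividing by the absolute value of [t] reduces the first two cases to [f - v0] and [f + v0],
     that is, to [c_le] and [c_ge]. *)
  have [t0|t0|t0] := ltrgtP t 0.
  + have nt0 : 0 < (- t)^-1 by rewrite invr_gt0 oppr_gt0.
    have := c_le _ _ (GZ (- t)^-1).
    have := CZ _ (ltW nt0).
    rewrite scalerDr scalerA invrN mulNr mulVf ?lt_eqF// scaleN1r => h /(_ h).
    rewrite mulNr mulrC -mulrN => h1.
    have : (- t) * c <= (- t) * (- (t^-1 * s)).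
      by rewrite ler_pM2l ?oppr_gt0// -mulNr mulrC mulrN -mulrN.
    rewrite mulrNN mulrA divff ?lt_eqF// mul1r; lra.
  + have := c_ge _ _ (GZ t^-1).
    have := CZ _ (ltW (etrans (invr_gt0 t) t0)).
    rewrite scalerDr scalerA mulVf ?gt_eqF// scale1r => h /(_ h).
    rewrite -(ler_pM2l t0) mulrN mulrA divff ?gt_eqF// mul1r; lra.
  + rewrite t0 mul0r addr0; apply: (posG _ _ Gf).
    by move: Cv; rewrite t0 scale0r addr0.
Qed.

(** A maximal graph has a value at every dominated vector, since [graph_step] would enlarge it
    otherwise. Where it has no value, [Lam] takes the default 0; hence linearity and positivity are
    claimed on dominated vectors only. *)
Lemma riesz_extension : exists Lam : V -> R,
  [/\ forall v, E v -> Lam v = L v,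
      forall (a b : R) v w, dominated v -> dominated w ->
        Lam (a *: v + b *: w) = a * Lam v + b * Lam w
    & forall v, dominated v -> C v -> 0 <= Lam v].
Proof.
pose GL : set (V * R) := [set x | E x.1 /\ x.2 = L x.1].
have PGL : positive_graph GL.
  split=> [v Ev //|a b v w r s [/= Ev ->] [/= Ew ->]|v r [/= Ev ->]].
    by split=> /=; [exact: subE|rewrite linL].
  exact: posL.
have [|G [PG maxG]] := @Zorn_bigcup _ [set G | G = set0 \/ positive_graph G].
  move=> F FP totF.
  have [[G0 FG0 PG0]|noF] := pselect (exists2 G, F G & positive_graph G); last first.
    left; apply/seteqP; split=> // x [G FG Gx].
    by have [GE|PG] := FP _ FG; [rewrite GE in Gx|apply: noF; exists G].
  right; split.
  - by move=> v Ev; exists G0 => //; case: PG0 => + _ _; exact.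
  - move=> a b v w r s [G1 FG1 G1v] [G2 FG2 G2w].
    have [G3 [FG3 G3v G3w]] : exists G3, [/\ F G3, G3 (v, r) & G3 (w, s)].
      by have [h|h] := totF _ _ FG1 FG2;
        [exists G2; split=> //; exact: h|exists G1; split=> //; exact: h].
    have [G3E|[_ + _]] := FP _ FG3; first by rewrite G3E in G3v.
    by move=> h; exists G3 => //; exact: h.
  - move=> v r [G1 FG1 G1v].
    have [G1E|[_ _ +]] := FP _ FG1; first by rewrite G1E in G1v.
    by move=> h; exact: h G1v.
have {PG}PG : positive_graph G.
  case: PG => // GE; exfalso; apply: (maxG GL); last by right.
  split; rewrite GE // => /(_ (0, L 0)); apply.
  by split.
have domG v : dominated v -> exists r, G (v, r).
  move=> /(graph_step PG)[G' PG' [GG' [r G'v]]]; exists r.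
  apply: contrapT => nG; apply: (maxG G'); last by right.
  by split=> // /(_ _ G'v).
pose Lam v := xget 0 [set r | G (v, r)].
have LamE v r : G (v, r) -> Lam v = r.
  by move=> Gv; apply: xget_unique => // s Gs; exact: graph_unique Gs Gv.
case: (PG) => LG linG posG.
exists Lam; split.
- by move=> v Ev; apply: LamE; exact: LG.
- move=> a b v w /domG[r Gv] /domG[s Gw].
  by rewrite (LamE _ _ Gv) (LamE _ _ Gw); apply: LamE; exact: linG.
- by move=> v /domG[r Gv] Cv; rewrite (LamE _ _ Gv); exact: posG Gv Cv.
Qed.

End riesz_extension.

(** * Outer measure of a Daniell integral *)

(** [daniell_dom] provides truncations and positive parts, as these are dominated by the function
    they come from. [daniell_cvg] expresses convergence to 0 by the existence of one index, which
    suffices for decreasing sequences. *)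
Record daniell {R : realType} {X : topologicalType} (F : set (X -> R))
    (Lam : (X -> R) -> R) : Prop := Daniell {
  daniell_cont : forall f, F f -> continuous f;
  daniell0 : F (fun=> 0);
  daniell_lin : forall (a b : R) f g, F f -> F g ->
    F (fun x => a * f x + b * g x);
  daniell_dom : forall f g, F f -> continuous g ->
    (forall x, `|g x| <= `|f x|) -> F g;
  daniell_linear : forall (a b : R) f g, F f -> F g ->
    Lam (fun x => a * f x + b * g x) = a * Lam f + b * Lam g;
  daniell_pos : forall f, F f -> (forall x, 0 <= f x) -> 0 <= Lam f;
  daniell_cvg : forall u : nat -> X -> R, (forall n, F (u n)) ->
    (forall n x, 0 <= u n x) -> (forall n m x, (n <= m)%N -> u m x <= u n x) ->
    (forall x e, 0 < e -> exists n, u n x < e) ->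
    forall e : R, 0 < e -> exists n, Lam (u n) <= e }.

Section daniell_outer_measure.
Context {R : realType} {X : topologicalType}.
Variables (F : set (X -> R)) (Lam : (X -> R) -> R).
Hypothesis D : daniell F Lam.
Implicit Types (f g : X -> R) (A : set X).

Lemma daniellD f g : F f -> F g -> F (fun x => f x + g x).
Proof.
move=> Ff Fg; have := daniell_lin D 1 1 Ff Fg.
by under eq_fun do rewrite !mul1r.
Qed.

Lemma daniellB f g : F f -> F g -> F (fun x => f x - g x).
Proof.
move=> Ff Fg; have := daniell_lin D 1 (-1) Ff Fg.
by under eq_fun do rewrite mul1r mulN1r.
Qed.

Lemma daniellZ a f : F f -> F (fun x => a * f x).
Proof.
move=> Ff; have := daniell_lin D a 0 Ff Ff.
by under eq_fun do rewrite mul0r addr0.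
Qed.

Lemma daniell_linearD f g : F f -> F g ->
  Lam (fun x => f x + g x) = Lam f + Lam g.
Proof.
move=> Ff Fg; have := daniell_linear D 1 1 Ff Fg.
by under eq_fun do rewrite !mul1r; rewrite !mul1r.
Qed.

Lemma daniell_linearB f g : F f -> F g ->
  Lam (fun x => f x - g x) = Lam f - Lam g.
Proof.
move=> Ff Fg; have := daniell_linear D 1 (-1) Ff Fg.
by under eq_fun do rewrite mul1r mulN1r; rewrite mul1r mulN1r.
Qed.

Lemma daniell_linearZ a f : F f -> Lam (fun x => a * f x) = a * Lam f.
Proof.
move=> Ff; have := daniell_linear D a 0 Ff Ff.
by under eq_fun do rewrite mul0r addr0; rewrite mul0r addr0.
Qed.

Lemma daniell_linear0 : Lam (fun=> 0) = 0.
Proof.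
have := daniell_linearZ 0 (daniell0 D).
by under eq_fun do rewrite mul0r; rewrite mul0r.
Qed.

Lemma daniell_le f g : F f -> F g -> (forall x, f x <= g x) -> Lam f <= Lam g.
Proof.
move=> Ff Fg fg; rewrite -subr_ge0 -daniell_linearB//.
by apply: (daniell_pos D); [exact: daniellB|move=> x; rewrite subr_ge0].
Qed.

Lemma daniell_sum (h : nat -> X -> R) n : (forall k, F (h k)) ->
  F (fun x => \sum_(k < n) h k x) /\
  Lam (fun x => \sum_(k < n) h k x) = \sum_(k < n) Lam (h k).
Proof.
move=> Fh; elim: n => [|n [IHF IHL]].
  under eq_fun do rewrite big_ord0; rewrite big_ord0.
  by split; [exact: (daniell0 D)|exact: daniell_linear0].
under eq_fun do rewrite big_ord_recr /=; rewrite big_ord_recr /= -IHL.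
by split; [exact: daniellD|rewrite daniell_linearD].
Qed.

(* Allowing a monotone limit instead of a series makes the covers of countably
   many sets combine without reindexing a double sequence; the strict
   inequality makes the covered set open. *)
Definition cover_cost A (c : R) := exists h : nat -> X -> R,
  [/\ (forall n, F (h n)) /\ (forall n x, 0 <= h n x),
      forall n m x, (n <= m)%N -> h n x <= h m x,
      forall n, Lam (h n) <= c
    & forall x, A x -> exists n, 1 < h n x].

Definition daniell_outer A : \bar R :=
  ereal_inf [set c%:E | c in cover_cost A].

Lemma daniell_outer_ge0 A : (0 <= daniell_outer A)%E.
Proof.
apply: le_ereal_inf_tmp => _ [c [h [[Fh h0] _ hc _]] <-].
by rewrite lee_fin (le_trans _ (hc 0%N))//; exact: (daniell_pos D).
Qed.

Lemma daniell_outer_le A c : cover_cost A c -> (daniell_outer A <= c%:E)%E.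
Proof. by move=> Ac; apply: ereal_inf_lbound; exists c. Qed.

Lemma daniell_outer_lt A y : (daniell_outer A < y)%E ->
  exists2 c, cover_cost A c & (c%:E < y)%E.
Proof. by move=> /ereal_inf_lt[_ [c Ac <-]]; exists c. Qed.

Lemma daniell_outer0 : daniell_outer set0 = 0%E.
Proof.
apply/eqP; rewrite eq_le daniell_outer_ge0 andbT daniell_outer_le//.
exists (fun _ _ => 0); split=> // [|n]; last by rewrite daniell_linear0.
by split=> // n; exact: (daniell0 D).
Qed.

Lemma le_daniell_outer : {homo daniell_outer : A B / A `<=` B >-> (A <= B)%E}.
Proof.
move=> A B AB; apply: ereal_inf_le_tmp => _ [c [h [Fh hm hc hB]] <-].
by exists c => //; exists h; split=> // x /AB /hB.
Qed.

Lemma daniell_outer_fin_cost A (e : R) : 0 < e -> daniell_outer A != +oo%E ->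
  exists2 c, cover_cost A c & (c%:E <= daniell_outer A + e%:E)%E.
Proof.
move=> e0 Aoo.
have Afin : daniell_outer A \is a fin_num.
  by rewrite ge0_fin_numE ?daniell_outer_ge0// ltey.
have [|c Ac cA] := @daniell_outer_lt A (daniell_outer A + e%:E)%E.
  by rewrite lteDl// lte_fin.
by exists c => //; exact: ltW.
Qed.

(** With covers [h k] of the sets [A k], the diagonal sums of the [h k n] over [k < n] increase with
    [n] and cover the union: a point of [A k] is reached once [n] exceeds [k] and the index at which
    [h k] passes 1. *)
Lemma daniell_outer_sigma_subadditive : sigma_subadditive daniell_outer.
Proof.
move=> A; have [[i ioo]|Afin] := pselect (exists i, daniell_outer (A i) = +oo%E).
  by rewrite (nneseries_pinfty _ _ ioo) ?leey// => n _; exact: daniell_outer_ge0.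
apply/lee_addgt0Pr => e e0.
have e2 n : 0 < e / (2 ^ n.+1)%:R by rewrite divr_gt0// ltr0n expn_gt0.
have Aoo n : daniell_outer (A n) != +oo%E by apply/eqP => An; apply: Afin; exists n.
have /choice[c cP] n : exists c, cover_cost (A n) c /\
    (c%:E <= daniell_outer (A n) + (e / (2 ^ n.+1)%:R)%:E)%E.
  by have [c ? ?] := daniell_outer_fin_cost (e2 n) (Aoo n); exists c.
have /choice[h hP] n := (cP n).1.
have Fh k n : F (h k n) by have [[+ _] _ _ _] := hP k; exact.
have h0 k n x : 0 <= h k n x by have [[_ +] _ _ _] := hP k; exact.
have hm k n m x : (n <= m)%N -> h k n x <= h k m x.
  by have [_ + _ _] := hP k; exact.
have hc k n : Lam (h k n) <= c k by have [_ _ + _] := hP k; exact.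
set S := (X in (_ <= X)%E).
have Se : (\sum_(n <oo) (daniell_outer (A n) + (e / (2 ^ n.+1)%:R)%:E) <= S)%E.
  by apply: epsilon_trick; [move=> n; exact: daniell_outer_ge0|exact: ltW].
have cS n : ((\sum_(k < n) c k)%:E <= S)%E.
  apply: le_trans Se; rewrite -sumEFin.
  apply: le_trans (nneseries_lim_ge n _) => /=; last first.
    by move=> k _ _; rewrite adde_ge0 ?daniell_outer_ge0// lee_fin ltW.
  by rewrite big_mkord; apply: lee_sum => k _; exact: (cP k).2.
have [Soo|Sfin] := eqVneq S +oo%E; first by rewrite Soo leey.
have S0 : (0 <= S)%E by have := cS 0%N; rewrite big_ord0.
have {Sfin}Sfin : S \is a fin_num by rewrite ge0_fin_numE// ltey.
rewrite -(fineK Sfin); apply: daniell_outer_le.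
exists (fun n x => \sum_(k < n) h k n x); split.
- split=> [n|n x]; last by rewrite sumr_ge0.
  exact: (daniell_sum n (fun k => Fh k n)).1.
- move=> n m x nm; rewrite -!(big_mkord xpredT (fun k => h k _ x)).
  rewrite (big_cat_nat (leq0n n) nm)/= -[leLHS]addr0 lerD ?sumr_ge0//.
  by apply: ler_sum => k _; exact: hm.
- move=> n; rewrite (daniell_sum n (fun k => Fh k n)).2.
  rewrite -lee_fin fineK// (le_trans _ (cS n))// lee_fin.
  by apply: ler_sum => k _; exact: hc.
- move=> x [k _ Akx]; have [_ _ _ /(_ x Akx)[n hn]] := hP k.
  have kN : (k < maxn n k.+1)%N by rewrite leq_max ltnSn orbT.
  exists (maxn n k.+1); rewrite (bigD1 (Ordinal kN))//=.
  rewrite (lt_le_trans hn)// -[leLHS]addr0 lerD ?sumr_ge0//.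
  by apply: hm; rewrite leq_max leqnn.
Qed.

(** The factor lies between 0 and 1, so the product is dominated by [f] and remains in [F]. *)
Let capped_mul g (gc : continuous g) (g0 : forall x, 0 <= g x) f (k : nat) :
  F f -> (forall x, 0 <= f x) ->
  [/\ F (fun x => f x * Num.min 1 (k%:R * g x)),
      forall x, 0 <= f x * Num.min 1 (k%:R * g x)
    & forall x, f x * Num.min 1 (k%:R * g x) <= f x].
Proof.
move=> Ff f0.
have m0 x : 0 <= Num.min 1 (k%:R * g x) by rewrite le_min ler01 mulr_ge0.
have fm x : f x * Num.min 1 (k%:R * g x) <= f x.
  by rewrite ler_piMr// ge_min lexx.
have fm0 x : 0 <= f x * Num.min 1 (k%:R * g x) by rewrite mulr_ge0.
split=> //; apply: (daniell_dom D Ff) => [x|x]; last by rewrite !ger0_norm.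
apply: (@continuousM _ _ f (fun x => Num.min 1 (k%:R * g x)) x).
  exact: (daniell_cont D Ff).
apply: (@continuous_min _ _ (fun=> 1) (fun x => k%:R * g x) x).
  exact: cst_continuous.
by apply: continuousM; [exact: cst_continuous|exact: gc].
Qed.

(* A cover [h n] of [A] splits into the cover [h n * min 1 (n * g)] of
   [A `&` U] and, for [k] large, the cover [h n * (1 - min 1 (k * g))] of
   [A `&` ~` U], where [U] is the set of [x] such that [0 < g x]. *)
Lemma daniell_outer_caratheodory g : continuous g -> (forall x, 0 <= g x) ->
  forall A, (daniell_outer (A `&` [set x | (0 < g x)%R]) +
    daniell_outer (A `&` ~` [set x | (0 < g x)%R]) <= daniell_outer A)%E.
Proof.
move=> gc g0 A.
have [Aoo|Aoo] := eqVneq (daniell_outer A) +oo%E; first by rewrite Aoo leey.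
apply/lee_addgt0Pr => e e0.
have e20 : 0 < e / 2 by lra.
have [c [h [[Fh h0] hm hc hA]] cA] := daniell_outer_fin_cost e20 Aoo.
pose p (k : nat) x := Num.min 1 (k%:R * g x).
have hpF n k : F (fun x => h n x * p k x) by case: (capped_mul gc g0 k (Fh n) (h0 n)).
have hp0 n k x : 0 <= h n x * p k x.
  by case: (capped_mul gc g0 k (Fh n) (h0 n)) => _ + _; exact.
have hp1 n k x : h n x * p k x <= h n x.
  by case: (capped_mul gc g0 k (Fh n) (h0 n)) => _ _; exact.
have p0 k x : 0 <= p k x by rewrite le_min ler01 mulr_ge0.
have pm n m x : (n <= m)%N -> p n x <= p m x.
  move=> nm; rewrite le_min !ge_min lexx/=.
  by rewrite ler_wpM2r ?orbT// ler_nat.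
have p1 k x : p k x <= 1 by rewrite ge_min lexx.
have hpm n m x : (n <= m)%N -> h n x * p n x <= h m x * p m x.
  by move=> nm; rewrite ler_pM// ?hm ?pm.
pose S := range (fun n => Lam (fun x => h n x * p n x)).
have supS : has_sup S.
  split; first by exists (Lam (fun x => h 0%N x * p 0%N x)), 0%N.
  by exists c => _ [n _ <-]; rewrite (le_trans _ (hc n))// daniell_le.
(* This [k] brings [Lam (h k * p k)] within [e / 2] of [sup S]; the two covers then cost [sup S] and
   [c - sup S + e / 2], and the other [e / 2] is the excess of [c] over the outer measure of [A]. *)
have [_ [k _ <-] ak] := sup_adherent e20 supS.
have costU : cover_cost (A `&` [set x | 0 < g x]) (sup S).
  exists (fun n x => h n x * p n x); split=> //.
    by move=> n; apply: ub_le_sup; [case: supS|exists n].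
  move=> x [Ax gx]; have [n hn] := hA _ Ax.
  have [m gm] : exists m : nat, 1 <= m%:R * g x.
    exists (Num.truncn (g x)^-1).+1.
    by rewrite -ler_pdivrMr// div1r ltW// truncnS_gt.
  exists (maxn n m).
  have -> : p (maxn n m) x = 1.
    apply/min_idPl; rewrite (le_trans gm)// ler_wpM2r ?g0// ler_nat.
    by rewrite leq_max leqnn orbT.
  by rewrite mulr1 (lt_le_trans hn)// hm// leq_max leqnn.
(* The sequence starts at [k], so that the subtracted term [h (k + n) * p k] is at least
   [h k * p k]. Where [g] vanishes, so does [p k], and nothing is lost there. *)
have costC : cover_cost (A `&` ~` [set x | 0 < g x]) (c - sup S + e / 2).
  exists (fun n x => h (k + n)%N x - h (k + n)%N x * p k x); split.
  - split=> [n|n x]; first exact: daniellB.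
    by rewrite subr_ge0.
  - move=> n m x nm.
    rewrite -[in X in X - _](mulr1 (h _ x)) -mulrBr.
    rewrite -[in X in _ <= X - _](mulr1 (h _ x)) -mulrBr.
    by rewrite ler_wpM2r ?subr_ge0// hm// leq_add2l.
  - move=> n; rewrite daniell_linearB//.
    have H1 : Lam (fun x => h k x * p k x) <= Lam (fun x => h (k + n)%N x * p k x).
      by apply: daniell_le => // x; rewrite ler_wpM2r// hm// leq_addr.
    have := hc (k + n)%N; lra.
  - move=> x [Ax /negP gx]; have [n hn] := hA _ Ax.
    have -> : p k x = 0.
      apply/eqP; rewrite eq_le p0 andbT ge_min.
      by rewrite mulr_ge0_le0 ?orbT//; move: gx; rewrite -leNgt.
    by exists n; rewrite mulr0 subr0 (lt_le_trans hn)// hm// leq_addl.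
apply: le_trans (leeD (daniell_outer_le costU) (daniell_outer_le costC)) _.
apply: (@le_trans _ _ (c + e / 2)%:E).
  by rewrite -EFinD lee_fin; lra.
rewrite [in leRHS](splitr e) !EFinD addeA.
by rewrite leeD2r.
Qed.

(** Covers must exceed 1 strictly, whence the constant sequence [(1 + d) * g]; [d] is such that the
    extra cost [d * Lam g] is at most [e]. *)
Lemma daniell_outer_level_le g A : F g -> (forall x, 0 <= g x) ->
  (forall x, A x -> 1 <= g x) -> (daniell_outer A <= (Lam g)%:E)%E.
Proof.
move=> Fg g0 gA; apply/lee_addgt0Pr => e e0.
have L0 : 0 <= Lam g by exact: (daniell_pos D).
pose d := e / (1 + Lam g).
have d0 : 0 < d by rewrite divr_gt0// ltr_pwDl.
apply: (@le_trans _ _ ((1 + d) * Lam g)%:E).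
  apply: daniell_outer_le; exists (fun=> fun x => (1 + d) * g x); split=> //.
  - split=> [_|_ x]; first exact: daniellZ.
    by rewrite mulr_ge0//; lra.
  - by move=> _; rewrite daniell_linearZ.
  - by move=> x /gA g1; exists 0%N; nra.
rewrite -EFinD lee_fin mulrDl mul1r lerD2l /d.
by rewrite mulrAC ler_pdivrMr ?ltr_pwDl//; nra.
Qed.

(** For any cover [h], the positive parts of [g - h n] decrease to 0: on [A] because [h n]
    eventually exceeds 1, elsewhere because [g] vanishes. Continuity of [Lam] along them bounds
    [Lam g] by the cost of [h] up to [e]. *)
Lemma daniell_outer_level_ge g A : F g -> (forall x, 0 <= g x <= 1) ->
  (forall x, ~ A x -> g x = 0) -> ((Lam g)%:E <= daniell_outer A)%E.
Proof.
move=> Fg g01 gA; apply: le_ereal_inf_tmp => _ [c [h [[Fh h0] hm hc hA]] <-].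
rewrite lee_fin; apply/ler_addgt0Pr => e e0.
pose u n x := Num.max 0 (g x - h n x).
have Fu n : F (u n).
  have Fgh := daniellB Fg (Fh n).
  apply: (daniell_dom D Fgh) => x.
    apply: (@continuous_max _ _ (fun=> 0) (fun x => g x - h n x) x).
      exact: cst_continuous.
    exact: (daniell_cont D Fgh).
  by rewrite ger0_norm ?le_max ?lexx// ge_max normr_ge0 ler_norm.
have [|||n Lu] := daniell_cvg D Fu _ _ _ e0.
- by move=> n x; rewrite le_max lexx.
- move=> n m x nm; rewrite ge_max !le_max lexx/=.
  by rewrite lerB ?orbT// hm.
- move=> x d d0; have [/hA[n hn]|/gA g0] := pselect (A x); last first.
    by exists 0%N; rewrite gt_max d0 g0 (le_lt_trans _ d0)// subr_le0.
  exists n; rewrite gt_max d0 (le_lt_trans _ d0)// subr_le0.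
  by rewrite (le_trans _ (ltW hn))//; have /andP[] := g01 x.
have : Lam g <= Lam (fun x => h n x + u n x).
  apply: daniell_le => //; first exact: daniellD.
  by move=> x; rewrite -lerBlDl le_max lexx orbT.
rewrite daniell_linearD//.
by move/le_trans; apply; rewrite lerD.
Qed.

Lemma daniell_outer_open A y : (daniell_outer A < y)%E ->
  exists U, [/\ open U, A `<=` U & (daniell_outer U < y)%E].
Proof.
move=> /daniell_outer_lt[c [h [[Fh h0] hm hc hA]] cy].
exists (\bigcup_n (h n @^-1` [set r | 1 < r])); split.
- apply: bigcup_open => n _; apply: open_comp; last exact: open_gt.
  by move=> x _; exact: (daniell_cont D (Fh n)).
- by move=> x /hA[n hn]; exists n.
- apply: le_lt_trans cy; apply: daniell_outer_le; exists h; split=> //.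
  by move=> x [n _ hn]; exists n.
Qed.

End daniell_outer_measure.

(** * The Borel measure of a Daniell integral *)

(** The distance to the complement works unless the complement is empty; it is then infinite, and
    the constant 1 replaces it. *)
Lemma open_positivity_set {R : realType} {V : normedModType R} (O : set V) :
  open O -> exists g : V -> R,
    [/\ continuous g, forall x, 0 <= g x & O = [set x | 0 < g x]].
Proof.
move=> oO; have [OT|/set0P[a Oa]] := eqVneq (~` O) set0.
  exists (fun=> 1); split=> //; first exact: cst_continuous.
  by apply/seteqP; split=> [x _ //=|x _]; apply: contrapT => Ox; rewrite -[False]/(set0 x) -OT.
have dfin x : edist_inf (~` O) x \is a fin_num.
  rewrite ge0_fin_numE ?edist_inf_ge0//.
  apply: (@le_lt_trans _ _ (edist (x, a))).
    by apply: ereal_inf_lbound; exists a.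
  rewrite -ge0_fin_numE ?edist_ge0//; apply/edist_finP => /=.
  exists (`|x - a| + 1); first by rewrite ltr_wpDl.
  by rewrite -ball_normE /ball_/= ltrDl.
exists (fun x => fine (edist_inf (~` O) x)); split.
- by move=> x; apply: fine_cvg; rewrite fineK//; exact: edist_inf_continuous.
- by move=> x; rewrite fine_ge0// edist_inf_ge0.
- apply/seteqP; split=> [x Ox|x /=]; last first.
    by apply: contraPP => Ox; rewrite edist_inf0// ltxx.
  have /nbhs_ballP[e /= e0 xeO] := open_nbhs_nbhs (conj oO Ox).
  rewrite /= -lte_fin fineK// (@lt_le_trans _ _ e%:E)//.
  apply: le_ereal_inf_tmp => _ [b /= Ob <-].
  rewrite leNgt; apply/negP => xb; apply: Ob; apply: xeO.
  exact: (@edist_lt_ball _ _ e (x, b)).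
Qed.

Section daniell_measure.
Context {R : realType} {K : set (quat R)}.
Variables (F : set (K -> R)) (Lam : (K -> R) -> R).
Hypothesis D : daniell F Lam.

(** Only the trace of [B] on [K] is measured, so the resulting measure vanishes off [K]. *)
Let outer (B : set (quat R)) : \bar R :=
  daniell_outer F Lam (set_val @^-1` B).

Let outer_isOuterMeasure : isOuterMeasure R (quat R) outer.
Proof.
split.
- by rewrite /outer preimage_set0 (daniell_outer0 D).
- by move=> B; exact: daniell_outer_ge0.
- by move=> A B AB; apply: le_daniell_outer => x; exact: AB.
- move=> A; rewrite /outer preimage_bigcup.
  exact: (daniell_outer_sigma_subadditive D).
Qed.

Let mu : {outer_measure set (quat R) -> \bar R} :=
  HB.pack_for {outer_measure set (quat R) -> \bar R} outer outer_isOuterMeasure.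

Let open_caratheodory (O : set (quat R)) : open O -> mu.-caratheodory O.
Proof.
move=> oO; apply: le_caratheodory_measurable => /= A.
have [g [gc g0 OE]] := @open_positivity_set R 'rV[R]_4 O oO.
rewrite OE; apply: (@daniell_outer_caratheodory _ _ _ _ D (g \o set_val)).
  move=> x; apply: continuous_comp; last exact: gc.
  exact: initial_continuous.
by move=> x /=; exact: g0.
Qed.

Let borel_caratheodory (B : set (quat R)) : measurable B -> mu.-caratheodory B.
Proof.
have sC : sigma_algebra setT (mu.-caratheodory : set (set (quat R))).
  exact: (@sigma_algebra_measurable _ (caratheodory_type mu)).
have H : <<s @open (quat R) >> `<=` (mu.-caratheodory : set (set (quat R))).
  by apply: smallest_sub; [exact: sC|exact: open_caratheodory].
by move=> mB; apply: (H B).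
Qed.

Lemma daniell_measure : exists nu : {measure set (quat R) -> \bar R},
  forall B, nu B = daniell_outer F Lam (set_val @^-1` B).
Proof.
have m0 : mu set0 = 0%E by exact: outer_measure0.
have mge0 B : (0 <= mu B)%E by exact: outer_measure_ge0.
have ms : semi_sigma_additive (mu : set (quat R) -> \bar R).
  move=> A mA tA mbA.
  by apply: (@caratheodory_measure_sigma_additive R (quat R) mu A) => //;
    [move=> i|]; exact: borel_caratheodory.
have nuP := isMeasure.Build _ _ _ (mu : set (quat R) -> \bar R) m0 mge0 ms.
by exists (HB.pack_for {measure set (quat R) -> \bar R} (mu : set (quat R) -> \bar R) nuP).
Qed.

End daniell_measure.

(** * Representation of a Daniell integral *)

#[local] Arguments valL_ : simpl never.

Lemma valL_val {U V : Type} {A : set U} (v : V) (f : A -> V) (x : A) :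
  valL_ v f (set_val x) = f x.
Proof. exact: (congr1 (@^~ x) (valLK v f)). Qed.

Lemma valL_ind {U V : Type} {A : set U} (v : V) (f : A -> V)
    (P : U -> V -> Prop) :
  (forall x : A, P (set_val x) (f x)) -> forall x, A x -> P x (valL_ v f x).
Proof.
move=> fP x Ax; have := fP (SigSub (mem_set Ax)).
by rewrite -(valL_val v f).
Qed.

Lemma measurable_open_quat {R : realType} (O : set (quat R)) :
  open O -> measurable O.
Proof. by move=> oO; apply: sub_sigma_algebra. Qed.

Lemma measurable_closed_quat {R : realType} (C : set (quat R)) :
  closed C -> measurable C.
Proof.
move=> cC; rewrite -(setCK C); apply: measurableC.
by apply: measurable_open_quat; exact: closed_openC.
Qed.

Section daniell_integral.
Context {R : realType} {K : set (quat R)}.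
Hypothesis clK : closed K.
Implicit Types f g : K -> R.

Let mK : measurable K := measurable_closed_quat clK.

Lemma continuous_measurable_valL f : continuous f ->
  measurable_fun K (valL_ 0 f).
Proof.
move=> cf _; apply: (measurability _ (RGenOInfty.measurableE R)) => //.
move=> _ [_ [c ->] <-].
(* Openness in the induced topology unfolds to being the trace of an open set [U] of quaternions. *)
have [U oU UE] : open (f @^-1` [set r | c < r]).
  by apply: open_comp; [move=> x _; exact: cf|exact: open_gt].
have cU : forall x, K x -> (c < valL_ 0 f x) = (U x) :> Prop.
  apply: (@valL_ind _ _ _ _ f (fun x t => (c < t) = (U x) :> Prop)) => x.
  exact: (congr1 (@^~ x) (esym UE)).
rewrite (_ : _ `&` _ = K `&` U); last first.
  by apply/seteqP; split=> x [Kx] /= h; split=> //; move: h;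
    rewrite /= in_itv/= andbT cU.
by apply: measurableI => //; exact: measurable_open_quat.
Qed.

Variable nu : {measure set (quat R) -> \bar R}.

Let int f : \bar R := (\int[nu]_(x in K) (valL_ 0 f x)%:E)%E.

Let mE f : continuous f -> measurable_fun K (EFin \o valL_ 0 f).
Proof. by move=> cf; apply/measurable_EFinP; exact: continuous_measurable_valL. Qed.

Let ge0E f : (forall x, 0 <= f x) ->
  forall x, K x -> (0 <= (valL_ 0 f x)%:E)%E.
Proof.
move=> f0; apply: (@valL_ind _ _ _ _ f (fun _ t => (0 <= t%:E)%E)) => x.
by rewrite lee_fin.
Qed.

Let int_ge0 f : (forall x, 0 <= f x) -> (0 <= int f)%E.
Proof. by move=> f0; apply: integral_ge0; exact: ge0E. Qed.

Let le_valL f g : (forall x, f x <= g x) ->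
  forall x, K x -> valL_ 0 f x <= valL_ 0 g x.
Proof.
move=> fg; apply: (@valL_ind _ _ _ _ f (fun x t => t <= valL_ 0 g x)) => x.
by rewrite valL_val.
Qed.

Let le_int f g : continuous f -> continuous g -> (forall x, 0 <= f x) ->
  (forall x, f x <= g x) -> (int f <= int g)%E.
Proof.
move=> cf cg f0 fg; apply: ge0_le_integral => //; [exact: ge0E|exact: mE|exact: mE|].
by move=> x Kx; rewrite lee_fin le_valL.
Qed.

Lemma valLD f g x : K x -> valL_ 0 (fun y => f y + g y) x = valL_ 0 f x + valL_ 0 g x.
Proof.
move: x; apply: (@valL_ind _ _ _ _ (fun y => f y + g y)
  (fun x t => t = valL_ 0 f x + valL_ 0 g x)) => x.
by rewrite !valL_val.
Qed.

Let intD f g : continuous f -> continuous g -> (forall x, 0 <= f x) ->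
  (forall x, 0 <= g x) -> int (fun x => f x + g x) = (int f + int g)%E.
Proof.
move=> cf cg f0 g0; rewrite -ge0_integralD//; [|exact: ge0E|exact: mE|exact: ge0E|exact: mE].
by apply: eq_integral => x /set_mem Kx; rewrite valLD.
Qed.

Let level f c := K `&` valL_ 0 f @^-1` `]c, +oo[%classic.

Let level_preimage f c : set_val @^-1` (level f c) = [set x | c < f x].
Proof.
rewrite /level; apply/seteqP; split=> x /=; rewrite in_itv/= andbT valL_val.
  by case.
by move=> cx; split=> //; exact: set_valP.
Qed.

Let mlevel f c : continuous f -> measurable (level f c).
Proof. by move=> cf; apply: continuous_measurable_valL. Qed.

Let mindic g c : continuous g ->
  measurable_fun K (fun x => (\1_(level g c) x)%:E : \bar R).
Proof.
by move=> cg; apply/measurable_EFinP; apply: measurable_indic; exact: mlevel.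
Qed.

Let int_level g c d : continuous g -> 0 <= d ->
  (\int[nu]_(x in K) (d%:E * (\1_(level g c) x)%:E) = d%:E * nu (level g c))%E.
Proof.
move=> cg d0; rewrite ge0_integralZl_EFin//; last exact: mindic.
rewrite integral_indic//; last exact: mlevel.
by congr (_ * nu _)%E; apply/seteqP; split=> x; [case|case=> ? ?; do 2?split].
Qed.

(** This and [level_le_int] are the two Chebyshev bounds: [f] is compared with [d] times the
    indicator of a level set of [g]. *)
Let int_le_level f g c d : continuous f -> continuous g -> 0 <= d ->
  (forall x, 0 <= f x <= d) -> (forall x, g x <= c -> f x = 0) ->
  (int f <= d%:E * nu (level g c))%E.
Proof.
move=> cf cg d0 fd f0.
rewrite -int_level//; apply: ge0_le_integral => //.
- by apply: ge0E => x; case/andP: (fd x).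
- exact: mE.
- by apply: measurable_funeM; exact: mindic.
- apply: (@valL_ind _ _ _ _ f
    (fun x t => (t%:E <= d%:E * (\1_(level g c) x)%:E)%E)) => x.
  rewrite -EFinM lee_fin indicE; have /andP[_ fxd] := fd x.
  have [gc|gc] := leP (g x) c.
    by rewrite f0// mulr_ge0.
  rewrite mem_set ?mulr1//; split; first exact: set_valP.
  by rewrite /= in_itv/= andbT valL_val.
Qed.

Let level_le_int f g c d : continuous f -> continuous g -> 0 <= d ->
  (forall x, 0 <= f x) -> (forall x, c < g x -> d <= f x) ->
  (d%:E * nu (level g c) <= int f)%E.
Proof.
move=> cf cg d0 f0 fd.
rewrite -int_level//; apply: ge0_le_integral => //.
- by move=> x _; rewrite -EFinM lee_fin mulr_ge0.
- by apply: measurable_funeM; exact: mindic.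
- exact: mE.
- apply: (@valL_ind _ _ _ _ f
    (fun x t => (d%:E * (\1_(level g c) x)%:E <= t%:E)%E)) => x.
  rewrite -EFinM lee_fin indicE.
  have [xl|xl] := boolP (set_val x \in level g c); last by rewrite mulr0.
  rewrite mulr1 fd//; move/set_mem : xl => [_] /=.
  by rewrite in_itv/= andbT valL_val.
Qed.

Variables (F : set (K -> R)) (Lam : (K -> R) -> R).
Hypothesis D : daniell F Lam.
Hypothesis nuE : forall B, nu B = daniell_outer F Lam (set_val @^-1` B).

(** * Layer-by-layer comparison of the functional and the integral *)

Section layers.
Variables (f : K -> R) (d : R).
Hypotheses (Ff : F f) (f0 : forall x, 0 <= f x) (d0 : 0 < d).

Let cap (n : nat) x := Num.min (f x) (n%:R * d).
Let layer n x := cap n.+1 x - cap n x.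

Let nd_ge0 n : 0 <= n%:R * d. Proof. by rewrite mulr_ge0// ltW. Qed.
Let nSd n : n.+1%:R * d = n%:R * d + d. Proof. by rewrite -natr1 mulrDl mul1r. Qed.

Let cap_ge0 n x : 0 <= cap n x. Proof. by rewrite le_min f0 nd_ge0. Qed.

Let Fcap n : F (cap n).
Proof.
apply: (daniell_dom D Ff) => x.
  apply: (@continuous_min _ _ f (fun=> n%:R * d) x).
    exact: (daniell_cont D Ff).
  exact: cst_continuous.
by rewrite !ger0_norm// ge_min lexx.
Qed.

Let Flayer n : F (layer n). Proof. exact: (daniellB D). Qed.

Let cap_layer n x : cap n.+1 x = cap n x + layer n x.
Proof. by rewrite /layer addrC subrK. Qed.

Let layer_bound n x : 0 <= layer n x <= d.
Proof.
rewrite /layer /cap nSd !minElt; have := nd_ge0 n; have := d0.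
set c := n%:R * d.
by case: (ltP (f x) (c + d)); case: (ltP (f x) c) => *; apply/andP; split; lra.
Qed.

Let layer0 n x : f x <= n%:R * d -> layer n x = 0.
Proof.
rewrite /layer /cap nSd => fx; rewrite (min_idPl fx).
by rewrite (min_idPl _) ?subrr// (le_trans fx)// lerDl ltW.
Qed.

Let layer1 n x : n.+1%:R * d <= f x -> layer n x = d.
Proof.
rewrite /layer /cap nSd => fx.
have fx' : n%:R * d <= f x by rewrite (le_trans _ fx)// lerDl ltW.
by rewrite (min_idPr fx) (min_idPr fx') addrAC subrr add0r.
Qed.

(** [layer n] vanishes where [f] is at most [n%:R * d], equals [d] where [f] is at least
    [n.+1%:R * d], and lies between 0 and [d]. Hence both [Lam (layer n)] and [int (layer n)] lie
    between [m n.+1] and [m n]. *)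
Let m n : \bar R := (d%:E * nu (level f (n%:R * d)%R))%E.

Let Lam_le_m n : ((Lam (layer n))%:E <= m n)%E.
Proof.
rewrite /m nuE level_preimage -lee_pdivrMl// -EFinM.
rewrite -(daniell_linearZ D)//.
apply: (daniell_outer_level_ge D); first exact: (daniellZ D).
  move=> x; have /andP[l0 l1] := layer_bound n x.
  by rewrite mulr_ge0 ?invr_ge0 ?(ltW d0)//= mulrC ler_pdivrMr// mul1r.
by move=> x /negP; rewrite -leNgt => fx; rewrite layer0// mulr0.
Qed.

Let m_le_Lam n : (m n.+1 <= (Lam (layer n))%:E)%E.
Proof.
rewrite /m nuE level_preimage -lee_pdivlMl// -EFinM.
rewrite -(daniell_linearZ D)//.
apply: (daniell_outer_level_le D); first exact: (daniellZ D).
  move=> x; have /andP[l0 l1] := layer_bound n x.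
  by rewrite mulr_ge0 ?invr_ge0 ?(ltW d0).
by move=> x /= fx; rewrite layer1 ?(ltW fx)// mulVf// gt_eqF.
Qed.

Let int_le_m n : (int (layer n) <= m n)%E.
Proof.
apply: int_le_level => //; [exact: (daniell_cont D)|exact: (daniell_cont D)|exact: ltW|].
exact: layer0.
Qed.

Let m_le_int n : (m n.+1 <= int (layer n))%E.
Proof.
apply: level_le_int => //; [exact: (daniell_cont D)|exact: (daniell_cont D)|exact: ltW| |].
  by move=> x; case/andP: (layer_bound n x).
by move=> x fx; rewrite layer1// ltW.
Qed.

Let cap_sub_split n : (fun x => cap n.+2 x - cap 1 x) =
  (fun x => (cap n.+1 x - cap 1 x) + layer n.+1 x).
Proof. by apply/funext => x; rewrite (cap_layer n.+1) addrAC. Qed.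

Let Lam_cap n : Lam (cap n.+1) = Lam (cap n) + Lam (layer n).
Proof. by rewrite (funext (cap_layer n)) (daniell_linearD D). Qed.

Let int_cap n : int (cap n.+1) = (int (cap n) + int (layer n))%E.
Proof.
rewrite (funext (cap_layer n)) intD//; [exact: (daniell_cont D)|exact: (daniell_cont D)|].
by move=> x; case/andP: (layer_bound n x).
Qed.

Let cap_le n k x : (n <= k)%N -> cap n x <= cap k x.
Proof.
move=> nk; rewrite le_min !ge_min lexx/=.
by rewrite ler_pM2r// ler_nat nk orbT.
Qed.

(** The left side sums layers 1 to [n], the right side layers 0 to [n - 1], and [int (layer k.+1) <=
    m k.+1 <= Lam (layer k)]. Removing [cap 1] pays for the shift and avoids [m 0], which may be
    infinite. *)
Lemma int_cap_le n : (int (fun x => cap n.+1 x - cap 1 x)%R <= (Lam (cap n))%:E)%E.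
Proof.
elim: n => [|n IHn].
  have -> : (fun x => cap 1 x - cap 1 x) = cap 0.
    by apply/funext => x; rewrite subrr /cap mul0r (min_idPr _).
  rewrite (_ : int _ = 0%E) ?lee_fin ?(daniell_pos D)//.
  apply: integral0_eq; apply: (@valL_ind _ _ _ _ _ (fun _ t => t%:E = 0%E)) => x.
  by rewrite /cap mul0r (min_idPr _).
rewrite cap_sub_split intD; first last.
- by move=> x; case/andP: (layer_bound n.+1 x).
- by move=> x; rewrite subr_ge0 cap_le.
- exact: (daniell_cont D).
- by apply: (daniell_cont D); exact: (daniellB D).
rewrite Lam_cap EFinD leeD//.
exact: le_trans (int_le_m _) (m_le_Lam _).
Qed.

Lemma le_int_cap n : ((Lam (fun x => cap n.+1 x - cap 1 x)%R)%:E <= int (cap n))%E.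
Proof.
elim: n => [|n IHn].
  have -> : (fun x => cap 1 x - cap 1 x) = (fun=> 0).
    by apply/funext => x; rewrite subrr.
  by rewrite (daniell_linear0 D) int_ge0.
rewrite cap_sub_split (daniell_linearD D)//; last exact: (daniellB D).
by rewrite int_cap EFinD leeD//; exact: le_trans (Lam_le_m _) (m_le_int _).
Qed.

End layers.

(* [trunc n] is the difference of two caps at multiples of [n.+1%:R^-1]. *)
Lemma daniell_integral f : F f -> (forall x, 0 <= f x) -> int f = (Lam f)%:E.
Proof.
move=> Ff f0.
pose trunc (n : nat) x := Num.min (f x) n.+1%:R - Num.min (f x) n.+1%:R^-1.
have d0 n : 0 < n.+1%:R^-1 :> R by rewrite invr_gt0 ltr0n.
have cf := daniell_cont D Ff.
have Fmin (r : R) : 0 <= r -> F (fun x => Num.min (f x) r).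
  move=> r0; apply: (daniell_dom D Ff) => x.
    by apply: (@continuous_min _ _ f (fun=> r) x); [exact: cf|exact: cst_continuous].
  by rewrite !ger0_norm ?ge_min ?lexx// le_min f0.
(* For layers of height [n.+1%:R^-1], the cap of index [n.+1 ^ 2] is at height [n.+1] and the cap of
   index 1 at the height of one layer. The predecessor gives the index the successor form of
   [int_cap_le]. *)
have truncE n : trunc n = (fun x => Num.min (f x) (((n.+1 ^ 2).-1).+1%:R / n.+1%:R)
    - Num.min (f x) (1%:R / n.+1%:R)).
  apply/funext => x; rewrite /trunc prednK ?expn_gt0// natrX expr2.
  by rewrite mulfK ?gt_eqF ?ltr0n// div1r.
have Ft n : F (trunc n) by apply: (daniellB D); apply: Fmin; rewrite ?invr_ge0.
have invle n : n.+1%:R^-1 <= n.+1%:R :> R.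
  by rewrite (@le_trans _ _ 1)// ?invf_le1 ?ler1n// ltr0n.
have t0 n x : 0 <= trunc n x.
  by rewrite subr_ge0 le_min !ge_min lexx/= invle orbT.
have tf n x : trunc n x <= f x.
  by rewrite /trunc lerBlDr ler_wpDr ?ge_min ?lexx// le_min f0/= ltW.
have minle (r s : R) x : r <= s -> Num.min (f x) r <= Num.min (f x) s.
  by move=> rs; rewrite le_min !ge_min lexx/= rs orbT.
have tm n k x : (n <= k)%N -> trunc n x <= trunc k x.
  move=> nk; rewrite /trunc lerB//; apply: minle; first by rewrite ler_nat.
  by rewrite lef_pV2 ?posrE ?ltr0n// ler_nat.
have t_int n : (int (trunc n) <= (Lam f)%:E)%E.
  rewrite truncE; apply: le_trans (int_cap_le Ff f0 (d0 n) _) _.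
  rewrite lee_fin; apply: (daniell_le D) => //.
    by apply: Fmin; rewrite mulr_ge0// invr_ge0.
  by move=> x; rewrite ge_min lexx.
have t_Lam n : ((Lam (trunc n))%:E <= int f)%E.
  rewrite truncE; apply: le_trans (le_int_cap Ff f0 (d0 n) _) _.
  apply: le_int => //.
  - by apply: (daniell_cont D); apply: Fmin; rewrite mulr_ge0// invr_ge0.
  - by move=> x; rewrite le_min f0/= mulr_ge0// invr_ge0.
  - by move=> x; rewrite ge_min lexx.
have rest_small x e : 0 < e -> exists n, f x - trunc n x < e.
  move=> e0; pose n := maxn (Num.truncn (f x)) (Num.truncn e^-1).
  exists n; have fn : f x <= n.+1%:R.
    rewrite (le_trans (ltW (truncnS_gt _)))// ler_nat ltnS leq_max leqnn//.
  rewrite /trunc (min_idPl fn) opprB addrC subrK gt_min.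
  apply/orP; right; rewrite invf_plt ?posrE ?ltr0n//.
  by rewrite (lt_le_trans (truncnS_gt _))// ler_nat ltnS leq_max leqnn orbT.
(* The bounds for [trunc n] pass to the limit: for [Lam] by its continuity along the remainders,
   which decrease to 0, for the integral by monotone convergence. *)
apply/eqP; rewrite eq_le; apply/andP; split; last first.
  apply/lee_addgt0Pr => e e0.
  have [||||n Lr] := daniell_cvg D (u := fun n x => f x - trunc n x) _ _ _ _ e0.
  - by move=> n; exact: (daniellB D).
  - by move=> n x; rewrite subr_ge0.
  - by move=> n k x nk; rewrite lerB// tm.
  - exact: rest_small.
  rewrite -leeBlDr//; apply: le_trans (t_Lam n).
  rewrite -EFinB lee_fin lerBlDr -lerBlDl.
  by rewrite -(daniell_linearB D).
have -> : int f = limn (fun n => int (trunc n)).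
  rewrite -monotone_convergence//.
  - apply: eq_integral => x /set_mem Kx; apply/esym/cvg_lim => //.
    move: x Kx; apply: (@valL_ind _ _ _ _ f (fun x t =>
      (valL_ 0 (trunc n) x)%:E @[n --> \oo] --> t%:E)) => x.
    under eq_fun do rewrite valL_val.
    apply: cvg_EFin; first exact: nearW.
    apply/cvgrPdist_le => e e0.
    have [n xn] := rest_small x e e0.
    exists n => // k /= nk; rewrite ger0_norm ?subr_ge0//.
    by rewrite (le_trans _ (ltW xn))// lerB// tm.
  - by move=> n; apply: mE; exact: (daniell_cont D).
  - by move=> n; exact: ge0E.
  - by move=> x Kx n k nk; rewrite lee_fin le_valL// => y; exact: tm.
apply: lime_le; last by apply: nearW.
apply: ereal_nondecreasing_is_cvgn => n k nk; apply: le_int => //.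
- exact: (daniell_cont D).
- exact: (daniell_cont D).
- by move=> x; exact: tm.
Qed.

End daniell_integral.

(** * Adapted spaces *)

Section adapted_daniell.
Context {R : realType} {X : topologicalType}.
Variable E : set (X -> R).
Hypothesis adE : adapted E.

Let E0 : E (fun=> 0). Proof. by case: adE => [[[]]]. Qed.

Let linE (a b : R) f g : E f -> E g -> E (fun x => a * f x + b * g x).
Proof. by case: adE => [[[_ +] _] _ _ _]; exact. Qed.

Let contE f : E f -> continuous f.
Proof. by case: adE => [[_ +] _ _ _]; exact. Qed.

Let nneg0 : nneg_part E (fun=> 0). Proof. by split. Qed.

Let nneg_lin (a b : R) f g : 0 <= a -> 0 <= b -> nneg_part E f ->
  nneg_part E g -> nneg_part E (fun x => a * f x + b * g x).
Proof.
move=> a0 b0 [Ef f0] [Eg g0]; split; first exact: linE.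
by move=> x; rewrite addr_ge0// mulr_ge0.
Qed.

(** Finitely many functions of [E_+], each exceeding 1 on an open set, take care of all of [C], and
    their sum is the bound. The near-covering form of compactness makes this finite choice. *)
Lemma adapted_compact_bound (C : set X) : compact C ->
  exists2 h, nneg_part E h & forall x, C x -> 1 <= h x.
Proof.
move=> /compact_near_coveringP cC.
(* The filter of functions of [E_+] above a prescribed one; it is directed because a sum bounds both
   of its terms. *)
pose G : set_system (X -> R) := filter_from (nneg_part E)
  (fun e => [set f | nneg_part E f /\ forall x, e x <= f x]).
have FG : Filter G.
  apply: filter_from_filter; first by exists (fun=> 0).
  move=> e1 e2 e1E e2E; exists (fun x => 1 * e1 x + 1 * e2 x).
    exact: nneg_lin.
  move=> f [fE ef]; have [_ e10] := e1E; have [_ e20] := e2E.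
  by split; split=> // x; have := ef x; have := e10 x; have := e20 x; lra.
have [|h hE hC] := cC _ G (fun f x => 1 <= f x) FG.
  move=> x Cx; have [_ _ /(_ x)[e eE ex] _] := adE.
  (* The scaling gives [h x = 2], so that [h] exceeds 1 near [x]; the null term only fits the shape
     of [nneg_lin]. *)
  pose h y := 2 / e x * e y + 0 * 0.
  have hE : nneg_part E h.
    by apply: (@nneg_lin _ _ e (fun=> 0)) => //; rewrite divr_ge0// ltW.
  exists ([set y | 1 < h y], [set f | nneg_part E f /\ forall y, h y <= f y]).
    split=> /=; last by exists h.
    apply: open_nbhs_nbhs; split.
      by apply: (@open_comp _ _ h [set r | 1 < r]);
        [move=> y _; exact: (contE hE.1)|exact: open_gt].
    by rewrite /= /h mulr0 addr0 divfK ?gt_eqF// ltr1n.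
  by move=> [y f] [/= hy [_ hf]]; exact: le_trans (ltW hy) (hf y).
by exists h => // x Cx; apply: hC.
Qed.

Variable l : (X -> R) -> R.
Hypothesis linl : forall (a b : R) f g, E f -> E g ->
  l (fun x => a * f x + b * g x) = a * l f + b * l g.
Hypothesis posl : forall f, nneg_part E f -> 0 <= l f.

Lemma adapted_daniell : exists F Lam, [/\ daniell F Lam, E `<=` F,
  forall f, E f -> Lam f = l f &
  forall C, compact C ->
    exists2 h, F h /\ (forall x, 0 <= h x) & forall x, C x -> 1 <= h x].
Proof.
pose F := [set f : X -> R |
  continuous f /\ exists2 g, nneg_part E g & forall x, `|f x| <= g x].
have nnegF f : nneg_part E f -> F f.
  move=> [Ef f0]; split; first exact: contE.
  by exists f => // x; rewrite ger0_norm.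
have [|||Lam [LamE linLam posLam]] := @riesz_extension R (X -> R)
  [set f | forall x, 0 <= f x] E l _ linE linl _ E0.
- by move=> a b f g a0 b0 f0 g0 x; apply: addr_ge0; apply: mulr_ge0.
- by move=> f Ef f0; apply: posl.
- by move=> x.
have EF f : E f -> F f.
  move=> Ef; split; first exact: contE.
  have [_ EE _ _] := adE.
  have [g [Eg g0] [h [Eh h0] <-]] : [set (fun x => f x - g x) |
      f in nneg_part E & g in nneg_part E] f by rewrite -EE.
  exists (fun x => 1 * g x + 1 * h x); first by apply: nneg_lin.
  by move=> x; rewrite ler_norml; have := g0 x; have := h0 x => *; apply/andP; split; lra.
have linF (a b : R) f g : F f -> F g -> F (fun x => a * f x + b * g x).
  move=> [cf [f1 f1E ff1]] [cg [g1 g1E gg1]]; split.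
    have cM c (h : X -> R) : continuous h -> continuous (fun x => c * h x).
      by move=> ch x; apply: continuousM; [exact: cst_continuous|exact: ch].
    by move=> x; exact: (continuousD (cM a f cf x) (cM b g cg x)).
  exists (fun x => `|a| * f1 x + `|b| * g1 x); first exact: nneg_lin.
  move=> x; rewrite (le_trans (ler_normD _ _))// !normrM.
  by rewrite lerD// ler_wpM2l.
have Fdom f : F f -> exists2 e, E e &
    (forall x, 0 <= (e - f) x) /\ (forall x, 0 <= (e + f) x).
  move=> [_ [g [Eg g0] fg]]; exists g => //; split=> x.
    by rewrite subr_ge0 (le_trans (ler_norm _)).
  by have := fg x; rewrite ler_norml addrC -[(f + g) x]/(f x + g x) => /andP[+ _]; lra.
exists F, Lam; split.
- split.
  + by move=> f [].
  + exact: nnegF.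
  + exact: linF.
  + move=> f g [_ [f1 f1E ff1]] cg gf; split=> //; exists f1 => // x.
    exact: le_trans (gf x) (ff1 x).
  + by move=> a b f g /Fdom Ff /Fdom Fg; exact: linLam.
  + by move=> f /Fdom Ff f0; exact: posLam.
  (* Let [f] dominate [u 0] and let [g] control [f] at infinity. Outside [C] one has
     [u N <= f <= d * g]; on [C], by Dini, [u N < b <= b * h] for some [N]. So
     [u N <= d * g + b * h] everywhere, and [d], [b] are chosen to make each term contribute at most
     [e / 2] to [Lam]. *)
  + move=> u Fu u0 um ucvg e e0.
    have [_ [f fE uf]] := Fu 0%N.
    have [_ _ _ /(_ f fE)[g gE fg]] := adE.
    have lg0 : 0 < 1 + Lam g by rewrite ltr_pwDl// LamE ?posl//; case: gE.
    have de0 : 0 < e / 2 / (1 + Lam g) by rewrite !divr_gt0.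
    have [C cC fgC] := fg _ de0.
    have [h hE hC] := adapted_compact_bound cC.
    have lh0 : 0 < 1 + Lam h by rewrite ltr_pwDl// LamE ?posl//; case: hE.
    have ee0 : 0 < e / 2 / (1 + Lam h) by rewrite !divr_gt0.
    set d := e / 2 / (1 + Lam g) in de0 fgC.
    set b := e / 2 / (1 + Lam h) in ee0.
    have [|N _ uN] := (compact_near_coveringP C).1 cC _ \oo (fun n x => u n x < b) _.
      move=> x Cx; have [n un] := ucvg x _ ee0.
      exists ([set y | u n y < b], [set m | (n <= m)%N]).
        split=> /=; last by exists n.
        apply: open_nbhs_nbhs; split=> //.
        by apply: (@open_comp _ _ (u n) [set r | r < b]);
          [move=> y _; case: (Fu n) => + _; exact|exact: open_lt].
      by move=> [y m] [/= uy nm]; exact: le_lt_trans (um _ _ _ nm) uy.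
    exists N; have := uN N (leqnn N) => {}uN.
    have Fgh : F (fun x => d * g x + b * h x).
      by apply: nnegF; apply: nneg_lin => //; exact: ltW.
    have ugh x : 0 <= ((fun x => d * g x + b * h x) - u N) x.
      rewrite subr_ge0; have [_ g0] := gE; have [_ h0] := hE.
      have [Cx|nCx] := pselect (C x).
        have := uN x Cx; have := hC x Cx; have := g0 x => ? ? ?.
        have : b * 1 <= b * h x by rewrite ler_wpM2l// ltW.
        have : 0 <= d * g x by rewrite mulr_ge0// ltW.
        lra.
      have := uf x; have := um 0%N N x (leq0n N); have := fgC x nCx.
      rewrite ger0_norm// => ? ? ?.
      have : 0 <= b * h x by rewrite mulr_ge0// ltW.
      lra.
    have Lgh : Lam (fun x => d * g x + b * h x) = d * Lam g + b * Lam h.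
      by apply: linLam; apply: Fdom; exact: nnegF.
    have {}ugh x : 0 <= 1 * (d * g x + b * h x) + (-1) * u N x.
      by rewrite mul1r mulN1r; exact: ugh.
    have := posLam _ (Fdom _ (linF 1 (-1) _ _ Fgh (Fu N))) ugh.
    rewrite [Lam _]linLam ?Lgh; [|exact: Fdom|exact: Fdom].
    have dg : d * (1 + Lam g) = e / 2 by rewrite /d divfK// gt_eqF.
    have bh : b * (1 + Lam h) = e / 2 by rewrite /b divfK// gt_eqF.
    by lra.
- exact: EF.
- exact: LamE.
- move=> C /adapted_compact_bound[h hE hC]; exists h => //.
  by split; [exact: nnegF|exact: hE.2].
Qed.

End adapted_daniell.

(** * Radon property *)

Lemma compact_preimage_val {X : topologicalType} (K C : set X) :
  compact C -> C `<=` K -> compact (set_val @^-1` C : set K).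
Proof.
move=> cC CK G PG GC.
have [//|p [Cp clp]] := cC (fmap set_val G) (fmap_proper_filter set_val PG).
have [y yp] : exists y : K, set_val y = p by exists (SigSub (mem_set (CK _ Cp))).
exists y; split; first by rewrite /= yp.
move=> A B GA; rewrite nbhsE => -[U [[W oW WU] Uy] UB].
have [_ [[a Aa <-] Wa]] : (set_val @` A) `&` W !=set0.
  apply: clp.
    rewrite -[fmap _ _ _]/(G (set_val @^-1` (set_val @` A))).
    by apply: filterS GA => a Aa; exists a.
  by apply: open_nbhs_nbhs; split=> //; rewrite -yp; move: Uy; rewrite -WU.
by exists a; split=> //; apply: UB; rewrite -WU.
Qed.

Lemma hausdorff_quat {R : realType} : hausdorff_space (quat R).
Proof. exact: (@norm_hausdorff R 'rV[R]_4). Qed.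

(** Closed balls of the sup norm: an exhaustion by compact sets, by which inner regularity is
    reduced to subsets of a compact set. *)
Definition quat_cube {R : realType} (n : nat) : set (quat R) :=
  [set x | forall l, - n%:R <= quat_coord x l <= n%:R].

Lemma compact_quat_cube {R : realType} n : compact (@quat_cube R n).
Proof.
rewrite (_ : quat_cube n =
    [set v : 'rV[R]_4 | forall l, `[- n%:R, n%:R]%classic (v ord0 l)]); last first.
  by apply/seteqP; split=> x h l; have := h l; rewrite /= in_itv.
exact: (@rV_compact R 4 (fun=> `[- n%:R, n%:R]%classic)
  (fun=> @segment_compact _ _ _)).
Qed.

Lemma quat_cube_cover {R : realType} : \bigcup_n (@quat_cube R n) = setT.
Proof.
apply/seteqP; split=> // x _.
exists (\max_(l < 4) (Num.truncn `|quat_coord x l|).+1)%N => // l.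
rewrite -ler_norml (le_trans (ltW (truncnS_gt _)))// ler_nat.
exact: (@leq_bigmax _ (fun l => (Num.truncn `|quat_coord x l|).+1)).
Qed.

Lemma le_quat_cube {R : realType} n m : (n <= m)%N ->
  @quat_cube R n `<=` quat_cube m.
Proof.
move=> nm x xn l; have := xn l; rewrite -!ler_norml => /le_trans; apply.
by rewrite ler_nat.
Qed.

Section adapted_moment.
Context {R : realType} {K : set (quat R)}.
Hypothesis clK : closed K.

Let mK : measurable K := measurable_closed_quat clK.

Section radon.
Variables (F : set (K -> R)) (Lam : (K -> R) -> R).
Hypothesis D : daniell F Lam.
Variable nu : {measure set (quat R) -> \bar R}.
Hypothesis nuE : forall B, nu B = daniell_outer F Lam (set_val @^-1` B).
Hypothesis boundF : forall C : set K, compact C ->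
  exists2 h, F h /\ (forall x, 0 <= h x) & forall x, C x -> 1 <= h x.

Let mcompact (C : set (quat R)) : compact C -> measurable C.
Proof.
by move=> cC; apply: measurable_closed_quat; exact: compact_closed hausdorff_quat cC.
Qed.

Let nu_compact (C : set (quat R)) : compact C -> C `<=` K -> (nu C < +oo)%E.
Proof.
move=> cC CK; rewrite nuE.
have [h [Fh h0] hC] := boundF (compact_preimage_val cC CK).
apply: (@le_lt_trans _ _ (Lam h)%:E); last exact: ltry.
exact: (daniell_outer_level_le D).
Qed.

(* The complement of [B] in the compact set [C] is covered by an open set of
   almost the same measure; removing the latter from [C] leaves [Z]. *)
Let inner_compact (C B : set (quat R)) (e : R) : compact C -> C `<=` K ->
  measurable B -> B `<=` C -> 0 < e ->
  exists2 Z, compact Z /\ Z `<=` B & (nu B <= nu Z + e%:E)%E.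
Proof.
move=> cC CK mB BC e0.
have mC := mcompact cC.
have mCB : measurable (C `\` B) by exact: measurableD.
have fD : nu (C `\` B) \is a fin_num.
  rewrite ge0_fin_numE// (le_lt_trans _ (nu_compact cC CK))//.
  by rewrite le_measure ?inE//; exact: subDsetl.
have : (daniell_outer F Lam (set_val @^-1` (C `\` B)) < nu (C `\` B) + e%:E)%E.
  by rewrite -nuE lteDl// lte_fin.
move=> /(daniell_outer_open D)[U [[W oW WU] DU Ue]].
have mW : measurable W := measurable_open_quat oW.
exists (C `&` ~` W).
  split; first by apply: compact_closedI => //; exact: open_closedC.
  move=> x [Cx nWx]; apply: contrapT => nBx; apply: nWx.
  pose y : K := SigSub (mem_set (CK _ Cx)).
  by have := DU y (conj Cx nBx); rewrite -WU.
(* Adding the finite measure of the part of [C] outside [B] turns the left side into [nu C], which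
   [W] splits into two pieces. *)
rewrite -(leeD2rE _ _ fD).
have -> : (nu B + nu (C `\` B) = nu C)%E.
  by rewrite -measureU//; [rewrite setDUK|exact: setDIK].
have -> : nu C = (nu (C `&` ~` W) + nu (C `&` W))%E.
  rewrite addeC -measureU; last by rewrite setIACA setICr setI0.
  - by rewrite -setIUr setUCr setIT.
  - exact: measurableI.
  - by apply: measurableI => //; exact: measurableC.
rewrite -addeA leeD2l// [leRHS]addeC (le_trans _ (ltW Ue))// nuE.
by apply: le_daniell_outer => x [_ Wx]; rewrite -WU.
Qed.

(** [K] being closed, its intersections with the cubes are compact. Inner regularity inside each of
    them passes to [B] by continuity from below. *)
Lemma daniell_radon : radon_measure_on K nu.
Proof.
split; [|exact: nu_compact|].
  rewrite nuE (_ : _ @^-1` _ = set0) ?(daniell_outer0 D)//.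
  by apply/seteqP; split=> // x; apply; exact: set_valP.
move=> B mB BK; apply/eqP; rewrite eq_le; apply/andP; split; last first.
  apply: ge_ereal_sup => _ [Z [cZ ZB] <-].
  by rewrite le_measure ?inE//; exact: mcompact.
set s := ereal_sup _.
pose C n := K `&` quat_cube n.
have cC n : compact (C n).
  by rewrite /C setIC; apply: compact_closedI => //; exact: compact_quat_cube.
have Bn n : (nu (B `&` C n) <= s)%E.
  apply/lee_addgt0Pr => e e0.
  have [|||Z [cZ ZB] BZ] := @inner_compact (C n) (B `&` C n) e (cC n) _ _ _ e0.
  - by move=> x [].
  - by apply: measurableI => //; exact: mcompact.
  - by move=> x [].
  apply: le_trans BZ _; rewrite leeD2r//.
  apply: ereal_sup_ubound; exists Z => //; split=> //.
  by apply: subset_trans ZB _ => x [].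
have BE : B = \bigcup_n (B `&` C n).
  rewrite -setI_bigcupr -setI_bigcupr quat_cube_cover setIT.
  by apply/seteqP; split=> [x Bx|x []//]; split=> //; exact: BK.
have mBC n : measurable (B `&` C n) by apply: measurableI => //; exact: mcompact.
have cvgB : nu (B `&` C n) @[n --> \oo] --> nu B.
  rewrite [in X in _ --> X]BE; apply: nondecreasing_cvg_mu => //.
    by rewrite -BE.
  move=> n m nm; apply/subsetPset => x [Bx [Kx xn]]; split=> //; split=> //.
  exact: le_quat_cube nm _ xn.
rewrite -(cvg_lim _ cvgB)//; apply: lime_le; last exact: nearW.
by apply/cvg_ex; exists (nu B).
Qed.

End radon.

Variables (E : set (K -> R)) (l : (K -> R) -> R).
Hypothesis adE : adapted E.
Hypothesis linl : forall (a b : R) f g, E f -> E g ->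
  l (fun x => a * f x + b * g x) = a * l f + b * l g.
Hypothesis posl : forall f, nneg_part E f -> 0 <= l f.

(** For nonnegative [f] the integral equals the real number [l f], and this finiteness is
    integrability; differences of such functions exhaust [E]. *)
Lemma adapted_moment : exists nu : {measure set (quat R) -> \bar R},
  radon_measure_on K nu /\ forall f, E f ->
    nu.-integrable K (EFin \o valL_ 0 f) /\
    (\int[nu]_(x in K) (valL_ 0 f x)%:E = (l f)%:E)%E.
Proof.
have [F [Lam [DF EF LamE bF]]] := adapted_daniell adE linl posl.
have [nu nuE] := daniell_measure DF.
exists nu; split; first exact: (daniell_radon DF nuE bF).
have pos f : nneg_part E f -> nu.-integrable K (EFin \o valL_ 0 f) /\
    (\int[nu]_(x in K) (valL_ 0 f x)%:E = (l f)%:E)%E.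
  move=> [Ef f0].
  have If : (\int[nu]_(x in K) (valL_ 0 f x)%:E = (l f)%:E)%E.
    by rewrite -LamE//; apply: (daniell_integral clK DF nuE) => //; exact: EF.
  split=> //; apply/integrableP; split.
    apply/measurable_EFinP; apply: continuous_measurable_valL => //.
    by apply: (daniell_cont DF); exact: EF.
  under eq_integral => x /set_mem Kx.
    rewrite gee0_abs; last first.
      move: x Kx; apply: (@valL_ind _ _ _ _ f (fun _ t => (0 <= t%:E)%E)) => x.
      by rewrite lee_fin.
    over.
  by rewrite If ltry.
move=> f Ef; have [_ EE _ _] := adE.
have [g gE [h hE fE]] : [set (fun x => f x - g x) |
    f in nneg_part E & g in nneg_part E] f by rewrite -EE.
have [ig Ig] := pos g gE; have [ih Ih] := pos h hE.
have valf x : K x -> valL_ 0 f x = valL_ 0 g x - valL_ 0 h x.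
  rewrite -fE; move: x; apply: (@valL_ind _ _ _ _ (fun y => g y - h y)
    (fun x t => t = valL_ 0 g x - valL_ 0 h x)) => x.
  by rewrite !valL_val.
split.
  have := integrableB mK ig ih; apply: eq_integrable => // x /set_mem Kx.
  by rewrite /= valf.
rewrite (eq_integral (fun x => (valL_ 0 g x)%:E - (valL_ 0 h x)%:E)%E); last first.
  by move=> x /set_mem Kx; rewrite valf.
rewrite integralB_EFin// Ig Ih -EFinB -fE; congr _%:E.
have := linl 1 (-1) gE.1 hE.1.
by under eq_fun do rewrite mul1r mulN1r; rewrite mul1r mulN1r => ->.
Qed.

End adapted_moment.

(** * Quaternionic functionals *)

(** The real part makes the functional real-valued by construction; that it loses nothing on
    [her_real E] is derived from positivity in [LR]. *)
Definition her_functional {R : realType} {K : set (quat R)}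
    (L : (K -> quat R) -> quat R) (g : K -> R) : R :=
  qre (L (fun x => (g x)%:A)).

Section quaternion_coordinates.
Context {R : realType}.
Implicit Types (p q : quat R) (a : R).

Lemma quatA_coord a : (qre (a%:A : quat R) = a) * (qi (a%:A : quat R) = 0) *
  (qj (a%:A : quat R) = 0) * (qk (a%:A : quat R) = 0).
Proof. by rewrite !quatZE !mkquatE mulr1 mulr0. Qed.

Lemma quatM_coord p q :
  (qre (p * q) = qre p * qre q - qi p * qi q - qj p * qj q - qk p * qk q) *
  (qi (p * q) = qre p * qi q + qi p * qre q + qj p * qk q - qk p * qj q) *
  (qj (p * q) = qre p * qj q - qi p * qk q + qj p * qre q + qk p * qi q) *
  (qk (p * q) = qre p * qk q + qi p * qj q - qj p * qi q + qk p * qre q).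
Proof. by rewrite !mkquatE. Qed.

Lemma conjqA a : conjq (a%:A : quat R) = a%:A.
Proof.
by apply: quatP; rewrite /conjq !(mkquatE, quatA_coord) ?oppr0.
Qed.

Lemma quat_ge0P p : quat_ge0 p <-> 0 <= qre p /\ p = (qre p)%:A.
Proof.
split=> [[a a0 ->]|[p0 pE]]; first by rewrite quatA_coord.
by exists (qre p).
Qed.

Let ui : quat R := mkquat 0 1 0 0.
Let uj : quat R := mkquat 0 0 1 0.
Let uk : quat R := mkquat 0 0 0 1.

Context {K : set (quat R)}.
Variable E : set (K -> quat R).
Hypothesis subE : two_sided_subspace E.
Hypothesis conjE : conj_invariant E.
Implicit Types f : K -> quat R.

Let linE p q f g : E f -> E g -> E (fun x => p * f x + q * g x).
Proof.
move=> Ef Eg; have := subE.2 p 1 q 1 _ _ Ef Eg.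
by under eq_fun do rewrite !mulr1.
Qed.

Let mulE p f : E f -> E (fun x => p * f x).
Proof.
move=> Ef; have := linE p 0 Ef Ef.
by under eq_fun do rewrite mul0r addr0.
Qed.

Let her_realP (g : K -> R) : E (fun x => (g x)%:A) -> her_real E g.
Proof. by move=> Eg; split=> //; apply/funext => x /=; rewrite conjqA. Qed.

(** The real part is half the sum of [f] and its conjugate; the other coordinates are the real parts
    of [- i f], [- j f] and [- k f]. *)
Let her_real_qre f : E f -> her_real E (fun x => qre (f x)).
Proof.
move=> Ef; apply: her_realP.
have := linE (2^-1)%:A (2^-1)%:A Ef (conjE Ef).
congr E; apply/funext => x /=; apply: quatP;
  rewrite !(quatDE, quatM_coord, quatA_coord, mkquatE); lra.
Qed.

Let her_real_qi f : E f -> her_real E (fun x => qi (f x)).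
Proof.
move=> Ef; have := her_real_qre (mulE (mkquat 0 (-1) 0 0) Ef).
by congr (her_real E _); apply/funext => x; rewrite quatM_coord !mkquatE; ring.
Qed.

Let her_real_qj f : E f -> her_real E (fun x => qj (f x)).
Proof.
move=> Ef; have := her_real_qre (mulE (mkquat 0 0 (-1) 0) Ef).
by congr (her_real E _); apply/funext => x; rewrite quatM_coord !mkquatE; ring.
Qed.

Let her_real_qk f : E f -> her_real E (fun x => qk (f x)).
Proof.
move=> Ef; have := her_real_qre (mulE (mkquat 0 0 0 (-1)) Ef).
by congr (her_real E _); apply/funext => x; rewrite quatM_coord !mkquatE; ring.
Qed.

Lemma her_real_coord f l : E f -> her_real E (fun x => quat_coord (f x) l).
Proof.
move=> Ef; rewrite -[l]inord_val; case: l => -[|[|[|[|//]]]] /= _.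
- exact: her_real_qre.
- exact: her_real_qi.
- exact: her_real_qj.
- exact: her_real_qk.
Qed.

Variable L : (K -> quat R) -> quat R.
Hypothesis linL : quat_linear_on E L.

Let L_lin p q f g : E f -> E g ->
  L (fun x => p * f x + q * g x) = p * L f + q * L g.
Proof.
move=> Ef Eg; have := linL p 1 q 1 Ef Eg.
by under eq_fun do rewrite !mulr1; rewrite !mulr1.
Qed.

Lemma her_realE (g : K -> R) : her_real E g -> E (fun x => (g x)%:A).
Proof. by case. Qed.

Lemma linear_her_functional (a b : R) (f g : K -> R) : her_real E f -> her_real E g ->
  her_functional L (fun x => a * f x + b * g x) = a * her_functional L f + b * her_functional L g.
Proof.
move=> /her_realE Ef /her_realE Eg; rewrite /her_functional.
have -> : (fun x => (a * f x + b * g x)%:A : quat R) =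
    (fun x => a%:A * (f x)%:A + b%:A * (g x)%:A).
  by apply/funext => x; rewrite scalerDl -!scalerA !mulr_algl.
by rewrite L_lin// quatDE !mulr_algl !quatZE.
Qed.

(* [f = f_0 + f_1 i + f_2 j + f_3 k] with [f_l] in [her_real E]. *)
Lemma coord_linear_functional f :
  (forall g, her_real E g -> L (fun x => (g x)%:A) = (her_functional L g)%:A) ->
  E f -> forall l, quat_coord (L f) l = her_functional L (fun x => quat_coord (f x) l).
Proof.
move=> LR Ef.
have f0 := her_real_qre Ef; have f1 := her_real_qi Ef.
have f2 := her_real_qj Ef; have f3 := her_real_qk Ef.
have E01 := linE 1 ui (her_realE f0) (her_realE f1).
have E23 := linE uj uk (her_realE f2) (her_realE f3).
have LfE : L f = (1 * (her_functional L (fun x => qre (f x)))%:A +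
      ui * (her_functional L (fun x => qi (f x)))%:A) +
    (uj * (her_functional L (fun x => qj (f x)))%:A +
      uk * (her_functional L (fun x => qk (f x)))%:A).
  rewrite -!LR// -(L_lin 1 ui (her_realE f0) (her_realE f1)).
  rewrite -(L_lin uj uk (her_realE f2) (her_realE f3)).
  have := L_lin 1 1 E01 E23; rewrite !mul1r => <-; congr L.
  apply/funext => x; apply: quatP;
    rewrite !(quatDE, quatM_coord, quatA_coord, mkquatE); ring.
move=> l; rewrite -[l]inord_val; case: l => -[|[|[|[|//]]]] /= _.
- rewrite -/(qre _) LfE !(quatDE, quatM_coord, quatA_coord, mkquatE) /qre; ring.
- rewrite -/(qi _) LfE !(quatDE, quatM_coord, quatA_coord, mkquatE) /qi; ring.
- rewrite -/(qj _) LfE !(quatDE, quatM_coord, quatA_coord, mkquatE) /qj; ring.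
- rewrite -/(qk _) LfE !(quatDE, quatM_coord, quatA_coord, mkquatE) /qk; ring.
Qed.

End quaternion_coordinates.

(** * The cycle of positivity, perturbed positivity and integral representation *)

Theorem theorem3p7 (R : realType) (K : set (quat R)) (clK : closed K)
    (E : set (K -> quat R))
    (contE : forall f, E f -> continuous f)
    (subE : two_sided_subspace E)
    (conjE : conj_invariant E)
    (adE : adapted (her_real E))
    (L : (K -> quat R) -> quat R)
    (linL : quat_linear_on E L) :
  [<-> positive_functional E L;
       forall f, her_nneg E f -> exists2 h, her_nneg E h &
         forall eps : R, 0 < eps -> quat_ge0 (L (fun x => f x + eps *: h x));
       moment_functional E L].
Proof.
have lE := linear_her_functional linL.
have LZ eps f h : E f -> E h -> L (fun x => f x + eps *: h x) = L f + eps *: L h.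
  move=> Ef Eh; have := linL 1 1 eps%:A 1 _ _ Ef Eh.
  by under eq_fun do rewrite !mulr1 mul1r mulr_algl; rewrite !mulr1 mul1r mulr_algl.
have herA (g : K -> R) : nneg_part (her_real E) g ->
    her_nneg E (fun x => (g x)%:A).
  by move=> [Eg g0]; split=> // x; exists (g x).
split.
  move=> posL f [[Ef fE] f0]; exists f => // eps eps0; rewrite LZ//.
  have [a a0 ->] : quat_ge0 (L f) by apply: posL.
  exists (a + eps * a); first by rewrite addr_ge0 ?mulr_ge0// ltW.
  by rewrite scalerDl scalerA.
split.
  move=> posL.
  have {}posL : positive_functional E L.
    move=> f fE; have [h hE Lfh] := posL f fE.
    have {}Lfh eps : 0 < eps -> [/\ 0 <= qre (L f) + eps * qre (L h),
        qi (L f) + eps * qi (L h) = 0, qj (L f) + eps * qj (L h) = 0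
      & qk (L f) + eps * qk (L h) = 0].
      move=> eps0; have := Lfh eps eps0; rewrite LZ; [|exact: fE.1.1|exact: hE.1.1].
      move=> [a a0 La].
      have := (congr1 qre La, congr1 qi La, congr1 qj La, congr1 qk La).
      by rewrite !(quatDE, quatA_coord) !quatZE => -[[[-> ->] ->] ->].
    (* The imaginary coordinates are affine in [eps] and vanish at 1 and 2, so their constant terms,
       those of [L f], are 0. The real part is handled by letting [eps] tend to 0. *)
    have [_ i1 j1 k1] := Lfh 1 ltr01.
    have [_ i2 j2 k2] := Lfh 2 (ltr0Sn R 1).
    exists (qre (L f)).
      apply/ler_addgt0Pr => e e0.
      have M0 : 0 < 1 + `|qre (L h)| by rewrite ltr_pwDl.
      have eM0 : 0 < e / (1 + `|qre (L h)|) by rewrite divr_gt0.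
      have [+ _ _ _] := Lfh _ eM0; move/le_trans; apply; rewrite lerD2l.
      rewrite mulrAC ler_pdivrMr// ler_wpM2l ?(ltW e0)//.
      by rewrite (le_trans (ler_norm _))// lerDr.
    by apply: quatP; rewrite quatA_coord//; lra.
  (* Adaptedness writes [g] as a difference of two functions on which positivity makes [L] real. *)
  have LR g : her_real E g -> L (fun x => (g x)%:A) = (her_functional L g)%:A.
    move=> Eg; have [_ EE _ _] := adE.
    have [g1 g1E [g2 g2E gE]] : [set (fun x => g1 x - g2 x) |
        g1 in nneg_part (her_real E) & g2 in nneg_part (her_real E)] g by rewrite -EE.
    have [a1 _ L1] := posL _ (herA _ g1E).
    have [a2 _ L2] := posL _ (herA _ g2E).
    rewrite /her_functional.
    have -> : (fun x => (g x)%:A : quat R) = (fun x => (g1 x)%:A + (-1) *: (g2 x)%:A).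
      by apply/funext => x; rewrite -gE scaleN1r scalerBl.
    rewrite LZ; [|exact: (her_realE g1E.1)|exact: (her_realE g2E.1)].
    by rewrite L1 L2 scaleN1r -scalerBl quatA_coord.
  have [nu [radon intE]] := adapted_moment clK adE lE
    (fun g gE => ((quat_ge0P _).1 (posL _ (herA g gE))).1).
  exists nu; split=> // f Ef.
  have coordE l x : K x ->
      coord_on f l x = valL_ 0 (fun y => quat_coord (f y) l) x.
    move: x; apply: (@valL_ind _ _ _ _ (fun y => quat_coord (f y) l)
      (fun x t => coord_on f l x = t)) => x.
    by rewrite /coord_on valL_val.
  have intf l := intE _ (her_real_coord subE conjE l Ef).
  split=> [l|].
    have := (intf l).1; apply: eq_integrable => [|x /set_mem Kx].
      exact: measurable_closed_quat.
    by rewrite /= coordE.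
  apply/rowP => l; rewrite mxE -/(quat_coord _ l).
  rewrite (coord_linear_functional subE conjE linL LR Ef) /Rintegral.
  rewrite (eq_integral (fun x => (valL_ 0 (fun y => quat_coord (f y) l) x)%:E)).
    by rewrite (intf l).2.
  by move=> x /set_mem Kx; rewrite coordE.
move=> [nu [_ intE]] f [[Ef fE] f0]; have [intf ->] := intE f Ef.
exists (qre (quat_integral nu f)).
  rewrite /qre /quat_coord mxE; apply: fine_ge0; apply: integral_ge0.
  apply: (@valL_ind _ _ _ _ f (fun x t => (0 <= (quat_coord t (inord 0))%:E)%E)) => x.
  by rewrite lee_fin; have /quat_ge0P[] := f0 x.
(* The premise singles out the imaginary coordinates, which vanish on the values of [f] and
   therefore in the integral. *)
have coord0 l : (forall a, quat_coord (a%:A : quat R) l = 0) ->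
    quat_coord (quat_integral nu f) l = 0.
  move=> l0; rewrite /quat_coord mxE /Rintegral integral0_eq//.
  apply: (@valL_ind _ _ _ _ f (fun x t => (quat_coord t l)%:E = 0%E)) => x.
  by have [a _ ->] := f0 x; rewrite l0.
by apply: quatP; rewrite quatA_coord//; apply: coord0 => a;
  rewrite -/(qi _) -/(qj _) -/(qk _) quatA_coord.
Qed.
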